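(* Let $G=(V,E)$ be a weighted graph with measure $\mu$ satisfying the standing assumptions given in the context, let $n\in(0,\infty)$ and $K\in\mathbb{R}$. Then the condition $CD(n,-K)$ is equivalent to each one of the following statements (each statement being required to hold pointwise on $V$ for all $t\ge 0$ and all positive bounded functions $0<f\in\ell^\infty(V,\mu)$): 1. $\displaystyle \Gamma(P_{t}f) \leq e^{2Kt}P_{t}(\Gamma(f))-\frac{2}{n}\int_{0}^{t}e^{2Ks}P_{s}\big((P_{t-s} \Delta f)^{2}\big)\, ds.$ 2. $\displaystyle \Gamma(P_{t}f) \leq e^{2Kt}P_{t}(\Gamma(f))-\frac{e^{2Kt}-1}{Kn}\left(P_{t} \Delta f\right)^{2}.$ 3. $\displaystyle P_{t}(f^{2})-(P_{t}f)^{2}\leq \frac{e^{2Kt}-1}{K}P_{t}(\Gamma(f))-\frac{e^{2Kt}-1-2Kt}{K^{2}n}\left(P_{t} \Delta f\right)^{2}.$ 4. $\displaystyle P_{t}(f^{2})-(P_{t}f)^{2}\geq \frac{1-e^{-2Kt}}{K}\Gamma(P_{t}f)+\frac{e^{-2Kt}-1+2Kt}{K^{2}n}\left(P_{t} \Delta f\right)^{2}.$ For $K=0$ the quotients are understood as their limits as $K\to0$: $\frac{e^{2Kt}-1}{K}$ and $\frac{1-e^{-2Kt}}{K}$ are read as $2t$, and $\frac{e^{2Kt}-1-2Kt}{K^2}$ and $\frac{e^{-2Kt}-1+2Kt}{K^2}$ are read as $2t^2$.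
   Context: Standing assumptions. $G=(V,E)$ is a connected (finite or infinite) graph with symmetric weight $\omega:V\times V\to[0,\infty)$, $\omega_{xy}=\omega_{yx}$, where $x\sim y$ (i.e. $xy$ is an edge) iff $\omega_{xy}>0$; $\omega_{\min}=\inf_{x\sim y}\omega_{xy}>0$; $G$ is locally finite, $m(x):=\sum_{y\sim x}\omega_{xy}<\infty$ for all $x$. $\mu:V\to(0,\infty)$ is a measure with $D_\mu:=\sup_{x\in V} m(x)/\mu(x)<\infty$. $\ell^\infty(V,\mu)$ is the space of bounded real functions on $V$ with the sup norm. Laplacian: $\Delta f(x)=\frac1{\mu(x)}\sum_{y\sim x}\omega_{xy}(f(y)-f(x))$. Gradient forms: $2\Gamma(f,g)=\Delta(fg)-f\Delta g-g\Delta f$, i.e. $2\Gamma(f,g)(x)=\frac1{\mu(x)}\sum_{y\sim x}\omega_{xy}(f(y)-f(x))(g(y)-g(x))$, $\Gamma(f)=\Gamma(f,f)$; $2\Gamma_2(f,g)=\Delta\Gamma(f,g)-\Gamma(f,\Delta g)-\Gamma(\Delta f,g)$, $\Gamma_2(f)=\Gamma_2(f,f)$. $CD(n,K)$: for every function $f:V\to\mathbb{R}$, $\Gamma_2(f)\ge\frac1n(\Delta f)^2+K\Gamma(f)$ pointwise on $V$. Heat semigroup: for a finite $U\subset V$ let $\overset{\circ}{U}=\{x\in U: y\in U\text{ for all }y\sim x\}$, let $\Delta_U$ be the Dirichlet Laplacian on $\ell^2(\overset{\circ}{U},\mu)$ (extend by $0$ outside $\overset{\circ}{U}$, apply $\Delta$,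 restrict to $\overset{\circ}{U}$), and let $p_U(t,x,y)=\sum_i e^{-\lambda_i t}\phi_i(x)\phi_i(y)$ for $x,y\in\overset{\circ}{U}$, where $(\phi_i)$ is an $\ell^2(\overset{\circ}{U},\mu)$-orthonormal basis of eigenfunctions of $-\Delta_U$ with eigenvalues $\lambda_i$; extend $p_U$ by $0$ to $V\times V$. For an exhaustion of $V$ by finite sets $U_k$ with $U_k\subset\overset{\circ}{U}_{k+1}$, $\bigcup_k U_k=V$, the heat kernel is $p_t(x,y)=\lim_{k\to\infty}p_{U_k}(t,x,y)$ (independent of the exhaustion). For $f\in\ell^\infty(V,\mu)$ and $t>0$, $P_tf(x)=\sum_{y\in V}\mu(y)p_t(x,y)f(y)$, and $P_0f=f$. *)

(* Defs.v *)
From HB Require Import structures.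
From mathcomp Require Import all_boot all_order all_algebra.
From mathcomp Require Import all_classical all_reals all_analysis.
Set Implicit Arguments.
Unset Strict Implicit.
Unset Printing Implicit Defensive.
Import Order.TTheory GRing.Theory Num.Theory.
Import numFieldNormedType.Exports.
Local Open Scope classical_set_scope.
Local Open Scope ring_scope.

(* Loops (wt x x > 0) are allowed; they do not contribute to the Laplacian. *)
Record weighted_graph (R : realType) (V : choiceType) := WeightedGraph {
  wt : V -> V -> R ;
  vol : V -> R ;
  wt_ge0 : forall x y, 0 <= wt x y ;
  wt_sym : forall x y, wt x y = wt y x ;
  graph_connected : forall x y,
    exists p : seq V, path (fun a b => 0 < wt a b) x p /\ last x p = y ;
  wt_min_gt0 :
    (0 < ereal_inf [set (wt e.1 e.2)%:E | e in [set e : V * V | (0 < wt e.1 e.2)%R]])%E ;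
  locally_finite : forall x, finite_set [set y | 0 < wt x y] ;
  vol_gt0 : forall x, 0 < vol x ;
  degree_vol_bounded :
    (ereal_sup
       (range (fun x => ((\sum_(y \in [set y | (0 < wt x y)%R]) wt x y) / vol x)%R%:E))
     < +oo)%E
}.

Section CurvatureDimension.
Context {R : realType} {V : choiceType} (G : weighted_graph R V).
Implicit Types (f g : V -> R) (x y : V).

Definition nbr x : set V := [set y | 0 < wt G x y].

Definition Delta f x : R :=
  (vol G x)^-1 * \sum_(y \in nbr x) wt G x y * (f y - f x).

Definition Gamma_bil f g x : R :=
  (Delta (f \* g) x - f x * Delta g x - g x * Delta f x) / 2.

Definition Gamma f : V -> R := Gamma_bil f f.

Definition Gamma2_bil f g x : R :=
  (Delta (Gamma_bil f g) x - Gamma_bil f (Delta g) x - Gamma_bil (Delta f) g x) / 2.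

Definition Gamma2 f : V -> R := Gamma2_bil f f.

Definition CD (n K : R) : Prop :=
  forall f x, Gamma2 f x >= n^-1 * Delta f x ^+ 2 + K * Gamma f x.

End CurvatureDimension.

Section HeatSemigroup.
Context {R : realType} {V : choiceType} (G : weighted_graph R V).
Implicit Types (f g : V -> R) (x y : V) (t : R) (U : set V).

Definition ginterior U : set V := [set x | U x /\ nbr G x `<=` U].

(* The elements of l^2(ginterior U) are represented by the functions on V that
   vanish outside ginterior U. *)
Definition l2_carrier U : set (V -> R) :=
  [set f | forall x, ~ ginterior U x -> f x = 0].

Definition l2_dot U f g : R := \sum_(x \in ginterior U) vol G x * f x * g x.

Definition dirichlet_Delta U f x : R :=
  if x \in ginterior U then
    Delta G (fun y => if y \in ginterior U then f y else 0) x
  else 0.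

Definition is_eigenbasis U (N : nat) (phi : 'I_N -> V -> R) (lam : 'I_N -> R) :
  Prop :=
  [/\ forall i, l2_carrier U (phi i),
      forall i j, l2_dot U (phi i) (phi j) = (i == j)%:R,
      forall f, l2_carrier U f ->
        exists c : 'I_N -> R, forall x, f x = \sum_i c i * phi i x
    & forall i x, - dirichlet_Delta U (phi i) x = lam i * phi i x].

(* The value does not depend on the eigenbasis; [get] selects it. *)
Definition dirichlet_heat_kernel U t x y : R :=
  get [set r | exists (N : nat) (phi : 'I_N -> V -> R) (lam : 'I_N -> R),
         is_eigenbasis U phi lam /\
         r = \sum_i expR (- lam i * t) * phi i x * phi i y].

Definition is_exhaustion (U : nat -> set V) : Prop :=
  [/\ forall k, finite_set (U k),
      forall k, U k `<=` ginterior (U k.+1)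
    & \bigcup_k U k = setT].

(* [get] selects the limit common to all exhaustions. *)
Definition heat_kernel t x y : R :=
  get [set l : R | forall U : nat -> set V, is_exhaustion U ->
         (fun k => dirichlet_heat_kernel (U k) t x y) @ \oo --> l].

(* Sum of an absolutely summable real family over V. *)
Definition vertex_sum f : R :=
  fine (\esum_(y in [set: V]) (Num.max (f y) 0)%:E) -
  fine (\esum_(y in [set: V]) (Num.max (- f y) 0)%:E).

Definition heat t f x : R :=
  if t == 0 then f x
  else vertex_sum (fun y => vol G y * heat_kernel t x y * f y).

End HeatSemigroup.

Definition pos_bounded {R : realType} {V : choiceType} (f : V -> R) : Prop :=
  (forall x, 0 < f x) /\ bounded_fun f.

(* [q], a quotient by a power of K, replaced at K = 0 by its limit [l]. *)
Definition quot_lim {R : realType} (K q l : R) : R := if K == 0 then l else q.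

(* Main.v *)
(** Since the degree/volume ratio is bounded, Delta is bounded for the sup norm.
    With [M] at least that ratio, [L = Delta + M] is a positive operator, so
    that [P_t = e^(-Mt) exp(t L)], given by a power series, is a positive
    semigroup differentiable in t. Expanding [dlt y / vol y] in a Dirichlet
    eigenbasis of a finite set U identifies the Dirichlet heat kernel with
    [e^(-Mt) exp(t L_U)], where [L_U] is L cut off outside the interior of U;
    along an exhaustion its nonnegative coefficients increase to those of L and
    agree with them up to any given order, so the heat semigroup is [P_t].

    If CD(n,-K) holds, differentiating [e^(2Ks) P_s (Gamma (P_(t-s) f))] in s
    produces [P_s (Gamma2 + K Gamma)], whence 1 and, by Jensen, 2;
    differentiating [P_s ((P_(t-s) f)^2)] produces [2 P_s (Gamma (P_(t-s) f))],
    to which 2 applies at time t - s (giving 3) or s (giving 4). Conversely both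
    sides agree at t = 0 to first order (2) or second order (3, 4), and the
    comparison of the next coefficients is CD(n,-K) for positive bounded f; as
    Gamma2 only sees f up to a constant on a ball of radius 2, this is enough. *)
Require Import Defs.
From HB Require Import structures.
From mathcomp Require Import all_boot all_order all_algebra.
From mathcomp Require Import all_classical all_reals all_analysis.
From mathcomp Require Import spectral complex ring lra.
Set Implicit Arguments.
Unset Strict Implicit.
Unset Printing Implicit Defensive.
Import Order.TTheory GRing.Theory Num.Theory.
Import numFieldNormedType.Exports.
Local Open Scope classical_set_scope.
Local Open Scope ring_scope.

(** * Diagonalization of real symmetric matrices *)

Lemma rv_dot_ge0 {R : realDomainType} {n} (v : 'rV[R]_n) : 0 <= (v *m v^T) 0 0.
Proof. by rewrite mxE sumr_ge0// => i _; rewrite mxE -expr2 sqr_ge0. Qed.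

Lemma rv_dot_eq0 {R : realDomainType} {n} (v : 'rV[R]_n) :
  ((v *m v^T) 0 0 == 0) = (v == 0).
Proof.
rewrite mxE psumr_eq0 => [|i _]; last by rewrite mxE -expr2 sqr_ge0.
apply/allP/eqP => [v0|v0 i _]; last by rewrite v0 !mxE mulr0 eqxx.
apply/rowP => i; have := v0 i (mem_index_enum i).
by rewrite mxE/= -expr2 sqrf_eq0 mxE => /eqP.
Qed.

(** Over the algebraically closed field [R[i]] there is an eigenvector [u = x + i y]. Symmetry
    forces its eigenvalue to be real, and then [x] or [y] is a real eigenvector. *)
Lemma symmetric_eigenvector {R : rcfType} {n} {A : 'M[R]_n} : (0 < n)%N ->
  A^T = A -> exists (a : R) (v : 'rV[R]_n), v != 0 /\ v *m A = a *: v.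
Proof.
move=> n0 symA; pose C := R[i].
have [c /eigenvalueP[u uA u0]] :=
  @eigenvalue_closed C n (map_mx (real_complex R) A) n0.
pose x : 'rV[R]_n := \row_j complex.Re (u 0 j).
pose y : 'rV[R]_n := \row_j complex.Im (u 0 j).
have part j : (u *m map_mx (real_complex R) A) 0 j =
    (((x *m A) 0 j) +i* ((y *m A) 0 j))%C.
  rewrite !mxE; under [LHS]eq_bigr do rewrite mxE.
  apply/eqP; rewrite eq_complex /= !raddf_sum /=.
  apply/andP; split; apply/eqP; apply: eq_bigr => k _;
    by rewrite !mxE; case: (u 0 k) => p q /=; ring.
have xA : x *m A = complex.Re c *: x - complex.Im c *: y.
  apply/rowP => j; have := part j; rewrite uA !mxE.
  by case: (c) (u 0 j) => [p q] [r s] /= [-> _].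
have yA : y *m A = complex.Re c *: y + complex.Im c *: x.
  apply/rowP => j; have := part j; rewrite uA !mxE.
  by case: (c) (u 0 j) => [p q] [r s] /= [_ <-]; ring.
have dotC (p q : 'rV[R]_n) : (p *m q^T) 0 0 = (q *m p^T) 0 0.
  by rewrite -[in RHS](trmxK q) -trmx_mul [RHS]mxE.
have xAy : (x *m A *m y^T) 0 0 = (y *m A *m x^T) 0 0.
  by rewrite dotC trmx_mul symA mulmxA.
(* Both sides of [xAy] are evaluated by [xA] and [yA]; the terms with the real part of [c]
   cancel. *)
have /eqP : complex.Im c * ((x *m x^T) 0 0 + (y *m y^T) 0 0) = 0.
  have comb (a b : R) (p q : 'M[R]_1) :
    (a *: p + b *: q) 0 0 = a * p 0 0 + b * q 0 0 by rewrite !mxE.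
  move: xAy; rewrite xA yA -scaleNr !mulmxDl -!scalemxAl !comb (dotC y x); lra.
have xy0 : (x *m x^T) 0 0 + (y *m y^T) 0 0 != 0.
  rewrite paddr_eq0 ?rv_dot_ge0// !rv_dot_eq0.
  apply/negP => /andP[/eqP x0 /eqP y0].
  move/eqP : u0; apply; apply/rowP => j; apply/eqP; rewrite eq_complex.
  move/rowP : x0 => /(_ j); move/rowP : y0 => /(_ j).
  by rewrite !mxE => -> ->/=; rewrite !eqxx.
rewrite mulf_eq0 (negbTE xy0) orbF => /eqP c0.
move: xA yA; rewrite c0 !scale0r subr0 addr0 => xA yA.
have [x0|x0] := eqVneq x 0; last by exists (complex.Re c), x.
exists (complex.Re c), y; split => //; apply: contra_neq xy0 => y0.
by rewrite x0 y0 !mul0mx mxE addr0.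
Qed.

(* For w = 0 the convention 2 / 0 = 0 makes this the identity. *)
Definition householder {R : fieldType} {n} (w : 'rV[R]_n) : 'M[R]_n :=
  1%:M - (2 / (w *m w^T) 0 0) *: (w^T *m w).

Lemma householder_sym {R : fieldType} {n} (w : 'rV[R]_n) :
  (householder w)^T = householder w.
Proof. by rewrite /householder linearB linearZ /= trmx_mul trmxK trmx1. Qed.

Lemma householderK {R : fieldType} {n} (w : 'rV[R]_n) :
  householder w *m householder w = 1%:M.
Proof.
rewrite /householder; set c := 2 / _.
rewrite mulmxBl mul1mx mulmxBr mulmx1 -scalemxAl -scalemxAr.
rewrite -mulmxA (mulmxA w) [w *m w^T]mx11_scalar mul_scalar_mx -scalemxAr.
rewrite !scalerA.
suff -> : c * (c * (w *m w^T) 0 0) = 2 * c.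
  by apply/matrixP => i j; rewrite !mxE; ring.
rewrite /c; have [->|w0] := eqVneq ((w *m w^T) 0 0) 0; last by field.
by rewrite invr0 !(mulr0, mul0r).
Qed.

(** For unit vectors the squared norm of [w = v - e] is twice the dot product of [v] and [w], so the
    reflection subtracts exactly [w] from [v]. *)
Lemma householderE {R : realFieldType} {n} {v e : 'rV[R]_n} :
  (v *m v^T) 0 0 = 1 -> (e *m e^T) 0 0 = 1 -> v *m householder (v - e) = e.
Proof.
move=> v1 e1; have ev : (e *m v^T) 0 0 = (v *m e^T) 0 0.
  by rewrite -[in LHS](trmxK e) -trmx_mul [LHS]mxE.
have vw : (v *m (v - e)^T) 0 0 = 1 - (v *m e^T) 0 0.
  by rewrite linearB /= mulmxBr -v1 !mxE.
have ww : ((v - e) *m (v - e)^T) 0 0 = 2 * (v *m (v - e)^T) 0 0.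
  rewrite vw; transitivity ((v *m v^T) 0 0 - (e *m v^T) 0 0 -
      ((v *m e^T) 0 0 - (e *m e^T) 0 0)); last by rewrite v1 e1 ev; ring.
  rewrite linearB /= mulmxBr !mulmxBl.
  have expB (p q r s : 'M[R]_1) : (p - q - (r - s)) 0 0 =
      p 0 0 - q 0 0 - (r 0 0 - s 0 0) by rewrite !mxE.
  by rewrite expB; ring.
rewrite /householder mulmxBr mulmx1 -scalemxAr mulmxA.
rewrite [v *m (v - e)^T]mx11_scalar mul_scalar_mx scalerA.
have [w0|w0] := eqVneq (v - e) 0.
  by rewrite w0 scaler0 subr0; apply/eqP; rewrite -subr_eq0; apply/eqP.
suff -> : 2 / ((v - e) *m (v - e)^T) 0 0 * (v *m (v - e)^T) 0 0 = 1.
  by rewrite scale1r opprB addrC subrK.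
by rewrite mulrAC -ww divff// rv_dot_eq0.
Qed.

(** Induction on the size. A reflection carries a unit eigenvector to the first basis vector; by
    symmetry the conjugated matrix is then block diagonal, and the induction hypothesis applies to
    its lower right block. The rows of [P] are the eigenvectors. *)
Theorem symmetric_diagonalization {R : rcfType} {n} {A : 'M[R]_n} :
  A^T = A -> exists (P : 'M[R]_n) (d : 'rV[R]_n),
    P *m P^T = 1%:M /\ P *m A = diag_mx d *m P.
Proof.
elim: n A => [|n IH] A symA.
  by exists 0, 0; split; apply/matrixP => -[].
have [a [v0 [v0_neq0 v0A]]] := symmetric_eigenvector (ltn0Sn n) symA.
pose v := (Num.sqrt ((v0 *m v0^T) 0 0))^-1 *: v0.
have vA : v *m A = a *: v by rewrite -scalemxAl v0A scalerA mulrC -scalerA.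
have v1 : (v *m v^T) 0 0 = 1.
  rewrite /v linearZ /= -scalemxAl -scalemxAr scalerA mxE -invfM -expr2.
  by rewrite sqr_sqrtr ?rv_dot_ge0// mulVf// rv_dot_eq0.
pose e : 'rV[R]_(1 + n) := row_mx 1%:M 0.
have e1 : (e *m e^T) 0 0 = 1.
  by rewrite /e tr_row_mx mul_row_col trmx1 mulmx1 mul0mx addr0 mxE.
pose H := householder (v - e).
have HH : H *m H = 1%:M := householderK _.
have HT : H^T = H := householder_sym _.
have vH : v *m H = e := householderE v1 e1.
have eH : e *m H = v by rewrite -vH -mulmxA HH mulmx1.
pose B : 'M[R]_(1 + n) := H *m A *m H.
have BT : B^T = B by rewrite /B !trmx_mul HT symA mulmxA.
have eB : e *m B = a *: e by rewrite /B !mulmxA eH vA -scalemxAl vH.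
have [ulB urB] : ulsubmx B = a%:M /\ ursubmx B = 0.
  move: eB; rewrite -[B in LHS]submxK /e mul_row_block !mul1mx !mul0mx !addr0.
  by rewrite scale_row_mx scaler0 scalemx1 => /eq_row_mx.
have dlB : dlsubmx B = 0.
  by rewrite -[B]BT -trmx_ursub urB trmx0.
have [P' [d' [PP' PB']]] := IH (drsubmx B) (etrans (trmx_drsub B) (congr1 drsubmx BT)).
pose Q : 'M[R]_(1 + n) := block_mx 1%:M 0 0 P'.
have QQ : Q *m Q^T = 1%:M.
  rewrite /Q tr_block_mx !trmx0 trmx1 mulmx_block.
  by rewrite !(mulmx0, mul0mx, mulmx1, addr0, add0r) PP' -scalar_mx_block.
pose d : 'rV[R]_(1 + n) := row_mx a%:M d'.
have QB : Q *m B = diag_mx d *m Q.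
  rewrite -[B]submxK ulB urB dlB /Q /d diag_mx_row !mulmx_block.
  rewrite !(mulmx0, mul0mx, mulmx1, mul1mx, addr0, add0r) PB'; congr block_mx.
  by apply/matrixP => i j; rewrite !ord1 !mxE !eqxx.
exists (Q *m H), d; split.
  by rewrite trmx_mul HT mulmxA -(mulmxA Q) HH mulmx1.
by rewrite mulmxA -QB /B -!mulmxA HH mulmx1.
Qed.

(** * Bounded functions and the Laplacian *)

Definition bdd {R : realType} {V : Type} (f : V -> R) :=
  exists C : R, forall x, `|f x| <= C.

Section Bounded.
Context {R : realType} {V : Type}.
Implicit Types f g : V -> R.

Lemma bdd_ge0 f : bdd f -> exists2 C : R, 0 <= C & forall x, `|f x| <= C.
Proof. by case=> C fC; exists `|C| => // x; apply: le_trans (ler_norm C). Qed.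

Lemma bddD f g : bdd f -> bdd g -> bdd (f + g).
Proof.
move=> [B fB] [C gC]; exists (B + C) => x.
by apply: le_trans (ler_normD _ _) _; rewrite lerD.
Qed.

Lemma bddZ a f : bdd f -> bdd (a *: f).
Proof. by move=> [C fC]; exists (`|a| * C) => x; rewrite normrM ler_wpM2l. Qed.

Lemma bddN f : bdd f -> bdd (- f).
Proof. by move=> [C fC]; exists C => x; rewrite normrN. Qed.

Lemma bddB f g : bdd f -> bdd g -> bdd (f - g).
Proof. by move=> ? ?; apply: bddD => //; exact: bddN. Qed.

Lemma bddM f g : bdd f -> bdd g -> bdd (f * g).
Proof.
move=> [B fB] [C gC]; exists (B * C) => x.
by rewrite normrM ler_pM.
Qed.

Lemma bdd_cst (c : R) : bdd (fun _ : V => c).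
Proof. by exists `|c|. Qed.

Lemma bounded_fun_bdd f : bounded_fun f -> bdd f.
Proof.
move=> [M [_ fM]]; exists (M + 1) => x.
by apply: (fM (M + 1)) => //; rewrite ltrDl.
Qed.

Lemma bdd_bounded_fun f : bdd f -> bounded_fun f.
Proof.
move=> [C fC]; exists C; split; first exact: num_real.
by move=> D /ltW CD x _; exact: le_trans (fC x) CD.
Qed.

End Bounded.

Section Laplacian.
Context {R : realType} {V : choiceType} (G : weighted_graph R V).
Implicit Types (f g : V -> R) (x y : V).

Definition nb x : seq V := finmap.enum_fset (fset_set (nbr G x)).

Lemma mem_nb x y : (y \in nb x) = (0 < wt G x y).
Proof.
apply/idP/idP.
  by rewrite in_fset_set; [rewrite inE|exact: locally_finite].
by move=> xy; rewrite in_fset_set ?inE//; exact: locally_finite.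
Qed.

Definition deg x := \sum_(y <- nb x) wt G x y.

(** The bound $D_\mu$ on the degree/volume ratio. The absolute value makes it nonnegative without a
    case distinction on whether [V] is empty. *)
Definition rate : R :=
  `|fine (ereal_sup (range (fun x =>
     ((\sum_(y \in [set y | (0 < wt G x y)%R]) wt G x y) / vol G x)%R%:E)))|.

Lemma deg_le_rate x : deg x / vol G x <= rate.
Proof.
have := degree_vol_bounded G; rewrite /rate /deg /nb.
set S := (X in ereal_sup X); move=> Soo.
have Sx : S (deg x / vol G x)%:E.
  by exists x => //; rewrite fsbig_finite//; exact: locally_finite.
have := ereal_sup_ubound Sx; move: Soo.
case: (ereal_sup S) => [r _|//|_ //]; rewrite lee_fin => /le_trans; apply.
exact: ler_norm.
Qed.

Lemma rate_ge0 : 0 <= rate. Proof. exact: normr_ge0. Qed.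

Lemma DeltaE f x : Delta G f x =
  (vol G x)^-1 * \sum_(y <- nb x) wt G x y * (f y - f x).
Proof. by rewrite /Delta fsbig_finite//; exact: locally_finite. Qed.

Lemma Delta_linear a f g : Delta G (a *: f + g) = a *: Delta G f + Delta G g.
Proof.
apply/funext => x; rewrite !fctE !DeltaE /GRing.scale/= mulrCA -mulrDr.
congr (_ * _); rewrite mulr_sumr -big_split; apply: eq_bigr => y _ /=; ring.
Qed.

Lemma Delta_cst (c : R) : Delta G (fun=> c) = 0.
Proof.
by apply/funext => x; rewrite DeltaE big1 ?mulr0// => y _; rewrite subrr mulr0.
Qed.

Definition gen f : V -> R := Delta G f + rate *: f.

(** In this form all coefficients are nonnegative, the diagonal one by [deg_le_rate]; this is what
    makes [gen] monotone. *)
Lemma genE f x : gen f x =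
  (vol G x)^-1 * \sum_(y <- nb x) wt G x y * f y
  + (rate - deg x / vol G x) * f x.
Proof.
rewrite /gen -[LHS]/(Delta G f x + rate * f x) DeltaE.
under eq_bigr do rewrite mulrBr.
by rewrite sumrB -mulr_suml /deg; ring.
Qed.

Lemma gen_linear a f g : gen (a *: f + g) = a *: gen f + gen g.
Proof.
rewrite /gen Delta_linear; apply/funext => x.
rewrite !fctE /GRing.scale/=; ring.
Qed.

Lemma gen_le f g x : (forall y, f y <= g y) -> gen f x <= gen g x.
Proof.
move=> fg; rewrite !genE lerD//; last by rewrite ler_wpM2l// subr_ge0 deg_le_rate.
rewrite ler_wpM2l//; first by rewrite invr_ge0 ltW// vol_gt0.
apply: ler_sum => y _; by rewrite ler_wpM2l// wt_ge0.
Qed.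

Lemma gen_cst c : gen (fun=> c) = (fun=> rate * c).
Proof. by rewrite /gen Delta_cst add0r. Qed.

Lemma gen0 : gen 0 = 0.
Proof. by rewrite (gen_cst 0) mulr0. Qed.

Lemma gen_ge0 f x : (forall y, 0 <= f y) -> 0 <= gen f x.
Proof. by move=> f0; have := @gen_le 0 f x f0; rewrite gen0. Qed.

(** Comparison with the constants [C] and [- C], on which [gen] is multiplication by [rate]. *)
Lemma gen_norm_le f C x : (forall y, `|f y| <= C) -> `|gen f x| <= rate * C.
Proof.
move=> fC; rewrite ler_norml; apply/andP; split.
  rewrite -mulrN -[leLHS]/((fun=> rate * - C) x) -gen_cst gen_le// => y.
  by have := fC y; rewrite ler_norml => /andP[].
rewrite -[leRHS]/((fun=> rate * C) x) -gen_cst gen_le// => y.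
exact: le_trans (ler_norm _) (fC y).
Qed.

Lemma iter_gen_norm_le f C k x : (forall y, `|f y| <= C) ->
  `|iter k gen f x| <= rate ^+ k * C.
Proof.
move=> fC; elim: k x => [|k IH] x; first by rewrite mul1r.
by rewrite iterS exprS -mulrA gen_norm_le.
Qed.

Lemma iter_gen_linear a f g k :
  iter k gen (a *: f + g) = a *: iter k gen f + iter k gen g.
Proof. by elim: k => //= k ->; rewrite gen_linear. Qed.

Lemma iter_gen_ge0 f k x : (forall y, 0 <= f y) -> 0 <= iter k gen f x.
Proof. by move=> f0; elim: k x => //= k IH x; exact: gen_ge0. Qed.

Lemma iter_gen_cst c k : iter k gen (fun=> c) = (fun=> rate ^+ k * c).
Proof.
elim: k => [|k IH]; first by apply/funext => x; rewrite mul1r.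
by rewrite iterS IH gen_cst; apply/funext => x; rewrite exprS mulrA.
Qed.

Lemma gen_bdd f : bdd f -> bdd (gen f).
Proof. by move=> [C fC]; exists (rate * C) => x; exact: gen_norm_le. Qed.

Lemma Delta_gen f : Delta G f = gen f - rate *: f.
Proof. by rewrite /gen addrK. Qed.

Lemma bdd_Delta f : bdd f -> bdd (Delta G f).
Proof.
by move=> bf; rewrite Delta_gen; apply: bddB; [exact: gen_bdd|exact: bddZ].
Qed.

Lemma Gamma_bilE f g : Gamma_bil G f g =
  2^-1 *: (Delta G (f * g) - f * Delta G g - g * Delta G f).
Proof. by apply/funext => x; rewrite /Gamma_bil mulrC. Qed.

Lemma bdd_Gamma_bil f g : bdd f -> bdd g -> bdd (Gamma_bil G f g).
Proof.
move=> bf bg; rewrite Gamma_bilE; apply: bddZ.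
have [bDf bDg] := (bdd_Delta bf, bdd_Delta bg).
have bDfg := bdd_Delta (bddM bf bg).
by apply: bddB (bddM bg bDf); apply: bddB (bddM bf bDg).
Qed.

Lemma Gamma_bilC f g : Gamma_bil G f g = Gamma_bil G g f.
Proof. by rewrite !Gamma_bilE [g * f]mulrC addrAC. Qed.

(** Pointwise convergence suffices because local finiteness makes [gen G f x] a finite combination
    of values of [f]. *)
Lemma gen_cvg (u : nat -> V -> R) f x : (forall y, u n y @[n --> \oo] --> f y) ->
  gen (u n) x @[n --> \oo] --> gen f x.
Proof.
move=> uf; rewrite genE; under eq_fun do rewrite genE.
apply: cvgD; last by apply: cvgMl_tmp; exact: uf.
apply: cvgMl_tmp; elim: (nb x) => [|y s IH].
  by rewrite big_nil; under eq_fun do rewrite big_nil; exact: cvg_cst.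
rewrite big_cons; under eq_fun do rewrite big_cons.
by apply: cvgD => //; apply: cvgMl_tmp; exact: uf.
Qed.

End Laplacian.

(** * Real derivatives *)

Section RealDerivatives.
Context {R : realType}.
Implicit Types (F : R -> R) (z : R).

Lemma is_derive_continuous F (z d : R) : is_derive z 1 F d ->
  {for z, continuous F}.
Proof.
by move=> dF; apply: differentiable_continuous; apply/derivable1_diffP.
Qed.

Lemma mean_value F F1 a h : (forall z : R, is_derive z 1 F (F1 z)) ->
  exists2 c, `|c - a| <= `|h| & F (a + h) - F a = h * F1 c.
Proof.
move=> dF; have cF (A : set R) : {within A, continuous F}.
  apply: continuous_subspaceT => z; exact: is_derive_continuous.
have [h0|h0] := leP 0 h.
  have [|c + ->] := @MVT_segment R F F1 a (a + h) _ (fun z _ => dF z) (cF _).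
    by rewrite lerDl.
  rewrite in_itv /= => /andP[ac ch]; exists c; last by ring.
  by rewrite !ger0_norm// ?subr_ge0// lerBlDl.
have [|c + E] := @MVT_segment R F F1 (a + h) a _ (fun z _ => dF z) (cF _).
  by rewrite gerDl ltW.
rewrite in_itv /= => /andP[ac ch]; exists c.
  by rewrite ler0_norm ?subr_le0// ltr0_norm// opprB lerBlDl -lerBlDr opprK.
by rewrite -[LHS]opprB E; ring.
Qed.

(** The mean value theorem is applied to [F] and then to [F1], which loses the factor 1/2 of the
    sharp constant. *)
Lemma taylor2 F F1 F2 a B : (forall z : R, is_derive z 1 F (F1 z)) ->
    (forall z : R, is_derive z 1 F1 (F2 z)) ->
    (forall z, `|z - a| <= 1 -> `|F2 z| <= B) ->
  forall h, `|h| <= 1 -> `|F (a + h) - F a - h * F1 a| <= B * h ^+ 2.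
Proof.
move=> dF dF1 bF2 h h1.
have [c ch ->] := mean_value a h dF.
have [d dh E] := mean_value a (c - a) dF1.
rewrite -mulrBr -[c in F1 c](subrKC a) E normrM normrM.
have dB : `|F2 d| <= B by apply: bF2; rewrite (le_trans dh)// (le_trans ch).
have -> : B * h ^+ 2 = `|h| * (`|h| * B).
  by rewrite mulrA -expr2 real_normK ?num_real// mulrC.
by rewrite ler_wpM2l// ler_pM.
Qed.

(** The difference quotient differs from [d] by at most [C] times the absolute value of [h]. *)
Lemma is_derive_quadratic F (s d C : R) :
    (forall h, `|h| <= 1 -> `|F (s + h) - F s - h * d| <= C * h ^+ 2) ->
  is_derive s 1 F d.
Proof.
move=> FC; have C0 : 0 <= C.
  by have := FC 1; rewrite normr1 lexx expr1n mulr1 => /(_ isT); exact: le_trans.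
have cF : h^-1 *: ((F \o shift s) (h *: 1) - F s) @[h --> 0^'] --> d.
  apply/cvgrPdist_le => /= e e0; near=> h.
  have h0 : h != 0 by near: h; exact: nbhs_dnbhs_neq.
  (* Dividing by [C + 1] rather than [C] covers the case [C = 0]. *)
  have hC : `|h| < e / (C + 1).
    near: h; apply: dnbhs0_lt; rewrite divr_gt0//; lra.
  have h1 : `|h| <= 1 by near: h; exact: dnbhs0_le.
  have := FC h h1; rewrite -[h ^+ 2]real_normK ?num_real// expr2 => FCh.
  have -> : d - h^-1 *: (F (h *: 1 + s) - F s) =
      - (h^-1 * (F (s + h) - F s - h * d)).
    by rewrite /GRing.scale/= mulr1 [h + s]addrC; field.
  rewrite normrN normrM normfV ler_pdivrMl ?normr_gt0//.
  rewrite (le_trans FCh)// mulrA mulrC ler_wpM2l//.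
  rewrite ltr_pdivlMr in hC; last lra.
  by have := normr_ge0 h; nra.
by apply: DeriveDef; [apply/cvg_ex; exists d|apply/cvg_lim].
Unshelve. all: by end_near. Qed.

Lemma nondecreasing_is_derive F F1 a b : (forall z : R, is_derive z 1 F (F1 z)) ->
  a <= b -> (forall z, a <= z <= b -> 0 <= F1 z) -> F a <= F b.
Proof.
move=> dF ab F1_ge0; have [|c + E] := @MVT_segment R F F1 a b ab (fun z _ => dF z).
  by apply: continuous_subspaceT => z; exact: is_derive_continuous.
by rewrite in_itv => cab; rewrite -subr_ge0 E mulr_ge0 ?F1_ge0// subr_ge0.
Qed.

Lemma constant_is_derive F a b : (forall z : R, is_derive z 1 F 0) -> F a = F b.
Proof.
move=> dF; have [c _] := @mean_value F (fun=> 0) a (b - a) dF.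
by rewrite mulr0 subrKC => /eqP; rewrite subr_eq0 => /eqP.
Qed.

(** Close to 0 the difference quotient is within [- d / 2] of [d], hence below [d / 2]. *)
Lemma derive_at0_le F (d : R) : is_derive (0 : R) 1 F d -> F 0 = 0 -> d < 0 ->
  exists2 r, 0 < r & forall t, 0 <= t <= r -> F t <= d / 2 * t.
Proof.
move=> dF F0 d0.
have cF : h^-1 *: ((F \o shift 0) (h *: 1) - F 0) @[h --> 0^'] --> d.
  rewrite -[X in _ --> X](@derive_val _ _ _ _ _ _ _ dF).
  exact: (@ex_derive _ _ _ _ _ _ _ dF).
have d2 : 0 < - d / 2 by lra.
have [r /= r0 rF] : \forall h \near 0^',
    `|d - h^-1 *: ((F \o shift 0) (h *: 1) - F 0)| < - d / 2.
  by move/cvgrPdist_lt : cF; exact.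
exists (r / 2) => [|t /andP[t0 tr]]; first by lra.
have [->|t_neq0] := eqVneq t 0; first by rewrite F0 mulr0.
have {}t0 : 0 < t by rewrite lt_neqAle eq_sym t_neq0.
have := rF t; rewrite /ball /= sub0r normrN gtr0_norm// => /(_ _ t_neq0).
rewrite /GRing.scale/= mulr1 addr0 F0 subr0 => /(_ ltac:(lra)).
rewrite distrC => /ltr_normlW tF; have : t^-1 * F t < d / 2 by lra.
by rewrite mulrC ltr_pdivrMr// => /ltW.
Qed.

Lemma derive_at0_ge0 F (d : R) : is_derive (0 : R) 1 F d -> F 0 = 0 ->
  (forall t, 0 <= t -> 0 <= F t) -> 0 <= d.
Proof.
move=> dF F0 F_ge0; rewrite leNgt; apply/negP => d0.
have [r r0 /(_ r)] := derive_at0_le dF F0 d0.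
rewrite lexx ltW// => /(_ isT); have := F_ge0 r (ltW r0); nra.
Qed.

(** If [d < 0], then [F1 z] lies below [d / 2 * z] just after 0; integrating, [F z] lies below
    [d / 4 * z ^+ 2], which is negative. *)
Lemma derive2_at0_ge0 F F1 (d : R) : (forall z : R, is_derive z 1 F (F1 z)) ->
  is_derive (0 : R) 1 F1 d -> F 0 = 0 -> F1 0 = 0 ->
  (forall t, 0 <= t -> 0 <= F t) -> 0 <= d.
Proof.
move=> dF dF1 F0 F10 F_ge0; rewrite leNgt; apply/negP => d0.
have [r r0 F1r] := derive_at0_le dF1 F10 d0.
have dH z : is_derive z 1 (fun z => d / 4 * z ^+ 2 - F z) (d / 2 * z - F1 z).
  have := dF z => dFz; apply: is_derive_eq.
  by rewrite /GRing.scale/= !mulr1; lra.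
have := @nondecreasing_is_derive _ _ 0 r dH (ltW r0).
rewrite F0 expr0n mulr0 subr0 => H.
have := F_ge0 r (ltW r0); rewrite leNgt => /negP; apply.
have : 0 <= d / 4 * r ^+ 2 - F r.
  by apply: H => z zr; rewrite subr_ge0 F1r.
rewrite subr_ge0 => /le_lt_trans; apply.
by rewrite nmulr_rlt0 ?exprn_gt0//; lra.
Qed.

End RealDerivatives.

(** * The heat semigroup as a power series *)

Section HeatExponential.
Context {R : realType} {V : choiceType} (G : weighted_graph R V).
Implicit Types (f g : V -> R) (x y : V) (t s : R).

Definition exp_coef f x k := (k`!%:R)^-1 * iter k (gen G) f x.

Definition exp_gen t f x := limn (pseries (exp_coef f x) t).

Lemma pseries_coef_le f C x t n : (forall y, `|f y| <= C) ->
  `|pseries (exp_coef f x) t n| <= expR (rate G * `|t|) * C.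
Proof.
move=> fC; have C0 : 0 <= C by rewrite (le_trans _ (fC x)).
have r0 : 0 <= rate G * `|t| by rewrite mulr_ge0// rate_ge0.
apply: (@le_trans _ _ (series (exp_coeff (rate G * `|t|)) n * C)).
  rewrite /pseries /series /= mulr_suml (le_trans (ler_norm_sum _ _ _))//.
  apply: ler_sum => k _; rewrite /exp_coeff /exp_coef /= !normrM normfV normr_nat.
  have -> : (rate G * `|t|) ^+ k / k`!%:R * C =
    k`!%:R^-1 * (rate G ^+ k * C) * `|t| ^+ k by rewrite exprMn; ring.
  rewrite normrX ler_wpM2r ?exprn_ge0// ler_wpM2l ?invr_ge0//.
  exact: iter_gen_norm_le.
rewrite ler_wpM2r// nondecreasing_cvgn_le//; last exact: is_cvg_series_exp_coeff.
apply: nondecreasing_series => k _ _; exact: exp_coeff_ge0.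
Qed.

(** By [iter_gen_norm_le] the series is dominated by a multiple of the exponential series. *)
Lemma exp_gen_is_cvg f x t : bdd f -> cvgn (pseries (exp_coef f x) t).
Proof.
move=> [C fC]; apply: normed_cvg.
have C0 : 0 <= C by rewrite (le_trans _ (fC x)).
have r0 : 0 <= rate G * `|t| by rewrite mulr_ge0// rate_ge0.
apply: (@series_le_cvg _ _ (C *: exp_coeff (rate G * `|t|))) => [|k|k|].
- by move=> k; exact: normr_ge0.
- by rewrite scalrfctE mulr_ge0// exp_coeff_ge0.
- rewrite /exp_coeff /exp_coef /= !normrM normfV normr_nat !fctE /GRing.scale/=.
  have -> : C * ((rate G * `|t|) ^+ k / k`!%:R) =
    k`!%:R^-1 * (rate G ^+ k * C) * `|t| ^+ k by rewrite exprMn; ring.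
  rewrite normrX ler_wpM2r ?exprn_ge0// ler_wpM2l ?invr_ge0//.
  exact: iter_gen_norm_le.
- apply: is_cvg_seriesZ; exact: is_cvg_series_exp_coeff.
Qed.

Lemma exp_gen_norm_le f C x t : (forall y, `|f y| <= C) ->
  `|exp_gen t f x| <= expR (rate G * `|t|) * C.
Proof.
move=> fC; have cf := @exp_gen_is_cvg f x t (ex_intro _ C fC).
rewrite ler_norml; apply/andP; split.
  apply: limr_ge => //; near=> n.
  by have := pseries_coef_le x t n fC; rewrite ler_norml => /andP[].
apply: limr_le => //; near=> n.
by have := pseries_coef_le x t n fC; rewrite ler_norml => /andP[].
Unshelve. all: by end_near. Qed.

(** Termwise form of the fact that [exp(tL) f] has derivative [exp(tL) (L f)]: the factor [k + 1]
    cancels in [(k + 1)!]. *)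
Lemma pseries_diffs_exp_coef f x :
  pseries_diffs (exp_coef f x) = exp_coef (gen G f) x.
Proof.
apply/funext => k; rewrite /pseries_diffs /exp_coef iterSr factS natrM invfM.
by rewrite mulrA mulVKf.
Qed.

Lemma is_derive_exp_gen f x t : bdd f ->
  is_derive t 1 (fun t => exp_gen t f x) (exp_gen t (gen G f) x).
Proof.
move=> bf; rewrite /exp_gen -pseries_diffs_exp_coef.
apply: (@pseries_snd_diffs _ _ (`|t| + 1)); rewrite ?pseries_diffs_exp_coef.
- exact: exp_gen_is_cvg.
- by apply/exp_gen_is_cvg/gen_bdd.
- by apply/exp_gen_is_cvg/gen_bdd/gen_bdd.
- by rewrite (ger0_norm (_ : 0 <= `|t| + 1)) ?ltrDl// addr_ge0.
Qed.

Lemma pseries_exp_coef_linear a f g x t n :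
  pseries (exp_coef (a *: f + g) x) t n =
  a * pseries (exp_coef f x) t n + pseries (exp_coef g x) t n.
Proof.
rewrite /pseries /series/= mulr_sumr -big_split; apply: eq_bigr => k _ /=.
by rewrite /exp_coef iter_gen_linear !fctE /GRing.scale/=; ring.
Qed.

Lemma exp_gen_linear a f g t : bdd f -> bdd g ->
  exp_gen t (a *: f + g) = a *: exp_gen t f + exp_gen t g.
Proof.
move=> bf bg; apply/funext => x; apply/cvg_lim => //.
have -> : pseries (exp_coef (a *: f + g) x) t = fun n =>
    a * pseries (exp_coef f x) t n + pseries (exp_coef g x) t n.
  by apply/funext => n; rewrite pseries_exp_coef_linear.
by apply: cvgD; [apply: cvgMl_tmp|]; exact: exp_gen_is_cvg.
Qed.

Lemma exp_gen_cst c t x : exp_gen t (fun=> c) x = expR (rate G * t) * c.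
Proof.
apply/cvg_lim => //.
have -> : pseries (exp_coef (fun=> c) x) t =
    (fun n => series (exp_coeff (rate G * t)) n * c).
  apply/funext => n; rewrite /pseries /series/= mulr_suml; apply: eq_bigr => k _.
  by rewrite /exp_coef /exp_coeff/= iter_gen_cst exprMn; ring.
by apply: cvgMr_tmp; exact: is_cvg_series_exp_coeff.
Qed.

Lemma exp_gen0 f x : bdd f -> exp_gen 0 f x = f x.
Proof.
move=> bf; apply: lim_near_cst => //; near=> n.
have /prednK <- : (0 < n)%N by near: n; exists 1%N.
rewrite /pseries /series/= big_nat_recl// big1 => [|k _].
  by rewrite /exp_coef fact0 invr1 mul1r expr0 mulr1 addr0.
by rewrite expr0n mulr0.
Unshelve. all: by end_near. Qed.

Lemma pseries_exp_coef_ge f x t n : 0 <= t -> (forall y, 0 <= f y) -> bdd f ->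
  pseries (exp_coef f x) t n <= exp_gen t f x.
Proof.
move=> t0 f0 bf; apply: nondecreasing_cvgn_le; last exact: exp_gen_is_cvg.
apply: nondecreasing_series => k _ _.
by rewrite mulr_ge0 ?exprn_ge0// mulr_ge0 ?invr_ge0// iter_gen_ge0.
Qed.

Lemma exp_gen_ge0 f x t : 0 <= t -> (forall y, 0 <= f y) -> bdd f ->
  0 <= exp_gen t f x.
Proof.
move=> t0 f0 bf; have := @pseries_exp_coef_ge f x t 0 t0 f0 bf.
by rewrite /pseries /series/= big_geq.
Qed.

(** On partial sums this is linearity of [gen]; [gen_cvg] then passes to the limit. *)
Lemma gen_exp_gen f t : bdd f -> gen G (exp_gen t f) = exp_gen t (gen G f).
Proof.
move=> bf; have genS n : gen G (fun y => pseries (exp_coef f y) t n) =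
    (fun y => pseries (exp_coef (gen G f) y) t n).
  elim: n => [|n IH].
    have Z (h : V -> R) : (fun y => pseries (exp_coef h y) t 0) = 0.
      by apply/funext => y; rewrite /pseries /series/= big_geq.
    by rewrite !Z gen0.
  have E (h : V -> R) : (fun y => pseries (exp_coef h y) t n.+1) =
      (t ^+ n / n`!%:R) *: iter n (gen G) h + (fun y => pseries (exp_coef h y) t n).
    apply/funext => y; rewrite /pseries /series/= big_nat_recr//= addrC !fctE.
    by rewrite /GRing.scale/= /exp_coef; ring.
  by rewrite !E gen_linear IH -iterSr.
apply/funext => x; apply/esym/cvg_lim => //.
have -> : pseries (exp_coef (gen G f) x) t =
    fun n => gen G (fun y => pseries (exp_coef f y) t n) x.
  by apply/funext => n; rewrite genS.
by apply: gen_cvg => y; exact: exp_gen_is_cvg.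
Qed.

End HeatExponential.

(** * The operators [e^(t Delta)] and the derivatives of curves of bounded functions *)

Section HeatFlow.
Context {R : realType} {V : choiceType} (G : weighted_graph R V).
Implicit Types (f g : V -> R) (x y : V) (t s : R) (u v : R -> V -> R).

Definition expheat t f : V -> R := expR (- rate G * t) *: exp_gen G t f.

Lemma expheat0 f : bdd f -> expheat 0 f = f.
Proof.
move=> bf; apply/funext => x; rewrite /expheat mulr0 expR0 scale1r.
exact: exp_gen0.
Qed.

Lemma expheat_linear a f g t : bdd f -> bdd g ->
  expheat t (a *: f + g) = a *: expheat t f + expheat t g.
Proof.
by move=> bf bg; rewrite /expheat exp_gen_linear// scalerDr !scalerA mulrC.
Qed.

Lemma expheatD f g t : bdd f -> bdd g ->
  expheat t (f + g) = expheat t f + expheat t g.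
Proof. by move=> bf bg; rewrite -[f in LHS]scale1r expheat_linear// scale1r. Qed.

Lemma expheat_cst c t : expheat t (fun=> c) = fun=> c.
Proof.
apply/funext => x; rewrite /expheat scalrfctE exp_gen_cst /GRing.scale/=.
by rewrite mulrA -expRD mulNr addNr expR0 mul1r.
Qed.

Lemma expheatZ a f t : bdd f -> expheat t (a *: f) = a *: expheat t f.
Proof.
move=> bf; rewrite -[a *: f]addr0 expheat_linear//; last exact: (bdd_cst 0).
by rewrite (expheat_cst 0) addr0.
Qed.

Lemma expheatN f t : bdd f -> expheat t (- f) = - expheat t f.
Proof. by move=> bf; rewrite -scaleN1r expheatZ// scaleN1r. Qed.

Lemma expheatB f g t : bdd f -> bdd g ->
  expheat t (f - g) = expheat t f - expheat t g.
Proof. by move=> bf bg; rewrite expheatD ?expheatN//; exact: bddN. Qed.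

Lemma expheat_ge0 f t : 0 <= t -> bdd f -> (forall y, 0 <= f y) ->
  forall x, 0 <= expheat t f x.
Proof. by move=> t0 bf f0 x; rewrite mulr_ge0 ?expR_ge0// exp_gen_ge0. Qed.

Lemma expheat_le f g t : 0 <= t -> bdd f -> bdd g -> (forall y, f y <= g y) ->
  forall x, expheat t f x <= expheat t g x.
Proof.
move=> t0 bf bg fg x; rewrite -subr_ge0.
rewrite -[_ - _]/((expheat t g - expheat t f) x) -expheatB//.
apply: expheat_ge0 => //; first exact: bddB.
by move=> y; rewrite !fctE subr_ge0.
Qed.

(** The prefactor and the series each contribute one [rate G] to the exponent. Negative times are
    included because time derivatives are taken at every real number. *)
Lemma expheat_norm_le f C t x : (forall y, `|f y| <= C) ->
  `|expheat t f x| <= expR (2 * rate G * `|t|) * C.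
Proof.
move=> fC; have C0 : 0 <= C by rewrite (le_trans _ (fC x)).
rewrite normrM (ger0_norm (expR_ge0 _)).
apply: le_trans (ler_wpM2l (expR_ge0 _) (exp_gen_norm_le G x t fC)) _.
rewrite mulrA ler_wpM2r// -expRD ler_expR.
have : - rate G * t <= rate G * `|t|.
  by rewrite mulNr -mulrN ler_wpM2l ?rate_ge0// -normrN ler_norm.
by rewrite -mulrA mulr_natl mulr2n lerD2r.
Qed.

Lemma bdd_expheat t f : bdd f -> bdd (expheat t f).
Proof.
by move=> [C fC]; exists (expR (2 * rate G * `|t|) * C) => x; exact: expheat_norm_le.
Qed.

Lemma expheat_norm_le_near s :
  exists2 B : R, 0 <= B & forall (C : R) g (z : R) x,
    `|z - s| <= 1 -> (forall y, `|g y| <= C) -> `|expheat z g x| <= B * C.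
Proof.
exists (expR (2 * rate G * (`|s| + 1))); first exact: expR_ge0.
move=> C g z x zs gC; have C0 : 0 <= C by rewrite (le_trans _ (gC x)).
apply: le_trans (expheat_norm_le z x gC) _.
rewrite ler_wpM2r// ler_expR ler_wpM2l ?mulr_ge0 ?rate_ge0//.
by rewrite -[z](subrKC s) (le_trans (ler_normD _ _))// lerD2l.
Qed.

Lemma is_derive_expheat f x t : bdd f ->
  is_derive t 1 (fun t => expheat t f x) (expheat t (Delta G f) x).
Proof.
move=> bf; have dE := is_derive_exp_gen G x t bf.
have d1 : is_derive t 1 (fun t => expR (- rate G * t)) (- rate G * expR (- rate G * t)).
  by apply: is_derive_eq; rewrite /GRing.scale/=; ring.
(* The right side is the product rule: differentiating the prefactor subtracts the [rate] by which
   [gen] exceeds [Delta]. *)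
have -> : expheat t (Delta G f) x = expR (- rate G * t) * exp_gen G t (gen G f) x
    + exp_gen G t f x * (- rate G * expR (- rate G * t)).
  rewrite Delta_gen addrC -scaleNr expheat_linear//; last exact: gen_bdd.
  by rewrite /expheat !fctE /GRing.scale/=; ring.
exact: is_deriveM.
Qed.

(** [gen] commutes with its own exponential, and [Delta] differs from it by a multiple of the
    identity. *)
Lemma Delta_expheat f t : bdd f -> Delta G (expheat t f) = expheat t (Delta G f).
Proof.
move=> bf; rewrite [in RHS]Delta_gen expheatB; [|exact: gen_bdd|exact: bddZ].
rewrite expheatZ// /expheat -gen_exp_gen// -[_ *: exp_gen _ _ _ in LHS]addr0.
rewrite Delta_linear (_ : Delta G 0 = 0); last exact: (Delta_cst G 0).
rewrite addr0 Delta_gen; apply/funext => x; rewrite !fctE /GRing.scale/=; ring.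
Qed.

Lemma Delta_norm_le f C x : (forall y, `|f y| <= C) ->
  `|Delta G f x| <= 2 * rate G * C.
Proof.
move=> fC; rewrite Delta_gen !fctE (le_trans (ler_normB _ _))//.
rewrite normrM (ger0_norm (rate_ge0 G)).
have := gen_norm_le G x fC; have := ler_wpM2l (rate_ge0 G) (fC x); lra.
Qed.

(* [f] is the derivative of [u] at [s] for the sup norm; asking for a quadratic
   remainder makes this stable under products by elementary estimates. *)
Definition uderiv u s f := [/\ forall t, bdd (u t), bdd f &
  exists C : R, forall h x, `|h| <= 1 ->
    `|u (s + h) x - u s x - h * f x| <= C * h ^+ 2].

(** The constant is uniform in [x] because the second time derivative, the flow of
    [Delta G (Delta G f)], is bounded uniformly on [V] for times within 1 of [t]. *)
Lemma expheat_taylor f t : bdd f -> exists C : R, forall h x, `|h| <= 1 ->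
  `|expheat (t + h) f x - expheat t f x - h * expheat t (Delta G f) x|
    <= C * h ^+ 2.
Proof.
move=> bf; have bDf := bdd_Delta G bf; have [C DDfC] := bdd_Delta G bDf.
have [B B0 H] := expheat_norm_le_near t.
exists (B * C) => h x h1.
apply: (taylor2 (F := fun z => expheat z f x)
  (F1 := fun z => expheat z (Delta G f) x)
  (F2 := fun z => expheat z (Delta G (Delta G f)) x)) => // z.
- exact: is_derive_expheat.
- exact: is_derive_expheat.
- by move=> zt; exact: H.
Qed.

Lemma uderiv_expheat f t s : bdd f ->
  uderiv (fun s => expheat (t - s) f) s (- Delta G (expheat (t - s) f)).
Proof.
move=> bf; rewrite Delta_expheat//; split.
- by move=> ?; exact: bdd_expheat.
- by apply/bddN/bdd_expheat/bdd_Delta.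
have [C HC] := expheat_taylor (t - s) bf; exists C => h x h1.
have := HC (- h) x; rewrite normrN sqrrN => /(_ h1).
by rewrite opprD addrA mulNr -[(- _ : V -> R) x]/(- _) mulrN.
Qed.

Lemma uderiv_linear a u v s f g : uderiv u s f -> uderiv v s g ->
  uderiv (fun s => a *: u s + v s) s (a *: f + g).
Proof.
move=> [bu bf [C uC]] [bv bg [D vD]]; split.
- by move=> t; exact: bddD (bddZ _ _) _.
- exact: bddD (bddZ _ _) _.
exists (`|a| * C + D) => h x h1; rewrite !fctE /GRing.scale/=.
have -> : a * u (s + h) x + v (s + h) x - (a * u s x + v s x) - h * (a * f x + g x)
  = a * (u (s + h) x - u s x - h * f x) + (v (s + h) x - v s x - h * g x) by ring.
rewrite (le_trans (ler_normD _ _))// mulrDl lerD ?vD// normrM -mulrA.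
by rewrite ler_wpM2l// uC.
Qed.

Lemma uderivB u v s f g : uderiv u s f -> uderiv v s g ->
  uderiv (fun s => u s - v s) s (f - g).
Proof.
move=> du dv; have := uderiv_linear (-1) dv du.
rewrite scaleN1r addrC; congr uderiv.
by apply/funext => t; rewrite scaleN1r addrC.
Qed.

(** Obtained from the operations already treated through [a f = ((a + 1) f + f) - (f + f)]. *)
Lemma uderivZ a u s f : uderiv u s f -> uderiv (fun s => a *: u s) s (a *: f).
Proof.
move=> du; have := uderivB (uderiv_linear (a + 1) du du) (uderiv_linear 1 du du).
have E (h : V -> R) : (a + 1) *: h + h - (1 *: h + h) = a *: h.
  by rewrite scalerDl scale1r opprD !addrA addrK addrK.
by rewrite E; congr uderiv; apply/funext => t; exact: E.
Qed.

Lemma uderivM u v s f g : uderiv u s f -> uderiv v s g ->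
  uderiv (fun s => u s * v s) s (f * v s + u s * g).
Proof.
move=> [bu bf [C uC]] [bv bg [D vD]]; split.
- by move=> t; exact: bddM.
- exact: bddD (bddM _ _) (bddM _ _).
have [A A0 uA] := bdd_ge0 (bu s); have [B B0 vB] := bdd_ge0 (bv s).
have [A' A'0 fA] := bdd_ge0 bf; have [B' B'0 gB] := bdd_ge0 bg.
have [bC bD] : 0 <= `|C| /\ 0 <= `|D| by [].
(* With [r] and [r'] the first-order remainders of [u] and [v], the four summands bound [u r'],
   [h^2 f g], [h f r'] and [r v(s + h)]; powers of [h] beyond the second are at most 1. *)
exists (A * `|D| + A' * B' + A' * `|D| + `|C| * (B + B' + `|D|)) => h x h1.
have := uC h x h1; have := vD h x h1; rewrite !fctE.
set r := u _ _ - _ - _; set r' := v _ _ - _ - _ => r'D rC.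
have h2 : 0 <= h ^+ 2 <= 1.
  by rewrite sqr_ge0 -real_normK ?num_real// exprn_ile1.
have {}rC : `|r| <= `|C| * h ^+ 2.
  by apply: le_trans rC _; rewrite ler_wpM2r ?ler_norm//; case/andP : h2.
have {}r'D : `|r'| <= `|D| * h ^+ 2.
  by apply: le_trans r'D _; rewrite ler_wpM2r ?ler_norm//; case/andP : h2.
have {h2} [h20 h21] := andP h2.
have r'D1 : `|r'| <= `|D| by apply: le_trans r'D _; rewrite ler_piMr.
have -> : u (s + h) x * v (s + h) x - u s x * v s x -
    h * (f x * v s x + u s x * g x) =
    u s x * r' + h ^+ 2 * (f x * g x) + h * f x * r' +
    r * (v s x + h * g x + r') by rewrite /r /r'; ring.
clearbody r r'.
apply: le_trans (ler_normD _ _) _; rewrite mulrDl.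
apply: lerD; last first.
  rewrite normrM mulrAC ler_pM//.
  do 2 (apply: le_trans (ler_normD _ _) _; apply: lerD => //).
  by rewrite normrM -[leRHS]mul1r ler_pM.
apply: le_trans (ler_normD _ _) _; rewrite mulrDl; apply: lerD; last first.
  rewrite normrM -mulrA ler_pM// normrM -[leRHS]mul1r ler_pM//.
apply: le_trans (ler_normD _ _) _; rewrite mulrDl; apply: lerD.
  by rewrite normrM -mulrA ler_pM.
rewrite normrM (ger0_norm h20) [leRHS]mulrC ler_wpM2l// normrM ler_pM//.
Qed.

(** [Delta] is linear and bounded for the sup norm, so it carries a quadratic remainder to a
    quadratic remainder. *)
Lemma uderiv_Delta u s f : uderiv u s f ->
  uderiv (fun s => Delta G (u s)) s (Delta G f).
Proof.
move=> [bu bf [C uC]]; split.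
- by move=> t; exact: bdd_Delta.
- exact: bdd_Delta.
exists (2 * rate G * C) => h x h1.
have -> : Delta G (u (s + h)) x - Delta G (u s) x - h * Delta G f x =
    Delta G (- h *: f + (-1 *: u s + u (s + h))) x.
  by rewrite !Delta_linear !fctE /GRing.scale/=; ring.
rewrite -mulrA; apply: Delta_norm_le => y.
by rewrite !fctE/=; have := uC h y h1; congr (`| _ | <= _); rewrite /GRing.scale/=; ring.
Qed.

Lemma uderiv_Gamma_bil u v s f g : uderiv u s f -> uderiv v s g ->
  uderiv (fun s => Gamma_bil G (u s) (v s)) s
    (Gamma_bil G f (v s) + Gamma_bil G (u s) g).
Proof.
move=> du dv.
have := uderivZ 2^-1 (uderivB (uderivB (uderiv_Delta (uderivM du dv))
  (uderivM du (uderiv_Delta dv))) (uderivM dv (uderiv_Delta du))).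
rewrite !Gamma_bilE; congr uderiv; first by apply/funext => t; rewrite Gamma_bilE.
rewrite -[f * v s]scale1r Delta_linear !scale1r; apply/funext => x.
by rewrite !fctE /GRing.scale/=; ring.
Qed.

(* [P_(s+h) u_(s+h) - P_s u_s] is split as
   [P_(s+h) (u_(s+h) - u_s - h u') + h (P_(s+h) u' - P_s u') + (P_(s+h) - P_s) u_s]
   up to [h P_s u'], each part being estimated to second order. *)
Lemma is_derive_expheat_curve u s f x : uderiv u s f ->
  is_derive s 1 (fun s => expheat s (u s) x)
    (expheat s (Delta G (u s)) x + expheat s f x).
Proof.
move=> [bu bf [C uC]].
have [B B0 H] := expheat_norm_le_near s.
have [A HA] := expheat_taylor s bf.
have [D HD] := expheat_taylor s (bu s).
have [E E0 HE] := bdd_ge0 (bdd_expheat s (bdd_Delta G bf)).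
apply: (@is_derive_quadratic _ _ _ _ (B * C + (`|A| + E) + D)) => h h1.
have h2 : `|h| ^+ 2 = h ^+ 2 by rewrite real_normK ?num_real.
(* The first-order remainder of [u], nested so that [expheat_linear] can be applied twice. *)
pose r := - h *: f + (-1 *: u s + u (s + h)).
have br : bdd r by do ?[apply: bddD|apply: bddZ|exact: bu|exact: bf].
have -> : expheat (s + h) (u (s + h)) x - expheat s (u s) x -
    h * (expheat s (Delta G (u s)) x + expheat s f x) =
  expheat (s + h) r x + h * (expheat (s + h) f x - expheat s f x) +
  (expheat (s + h) (u s) x - expheat s (u s) x - h * expheat s (Delta G (u s)) x).
  rewrite /r !expheat_linear//; last by apply: bddD => //; exact: bddZ.
  by rewrite !fctE /GRing.scale/=; ring.
apply: le_trans (ler_normD _ _) _; rewrite mulrDl; apply: lerD; last exact: HD.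
apply: le_trans (ler_normD _ _) _; rewrite mulrDl; apply: lerD.
  rewrite -mulrA; apply: H; first by rewrite addrC addKr.
  move=> y; rewrite /r !fctE/=; have := uC h y h1.
  by congr (`| _ | <= _); rewrite /GRing.scale/=; ring.
rewrite normrM -h2 expr2 mulrCA ler_wpM2l//.
have := HA h x h1; rewrite -h2 => HAh.
rewrite -[X in `|X|](subrK (h * expheat s (Delta G f) x)).
apply: le_trans (ler_normD _ _) _; rewrite mulrDl.
apply: lerD; last by rewrite normrM mulrC ler_wpM2r.
apply: le_trans HAh (le_trans (ler_wpM2r (sqr_ge0 _) (ler_norm A)) _).
by rewrite expr2 ler_wpM2l// ler_piMr.
Qed.

(** The left side has derivative zero in [s], since the flow commutes with [Delta]; its value at
    [s = 0] is the right side. *)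
Lemma expheat_semigroup f s t : bdd f -> expheat s (expheat (t - s) f) = expheat t f.
Proof.
move=> bf; apply/funext => x.
rewrite [LHS](@constant_is_derive _ (fun s => expheat s (expheat (t - s) f) x) s 0).
  by rewrite subr0 expheat0//; exact: bdd_expheat.
move=> z; have := is_derive_expheat_curve x (uderiv_expheat t z bf).
rewrite expheatN; last exact/bdd_Delta/bdd_expheat.
by rewrite -[(- _ : V -> R) x]/(- _) subrr.
Qed.

(** Jensen's inequality: the flow preserves constants and positivity, and is applied to [(f - c)^2]
    with [c] the value of the flow of [f] at [x]. *)
Lemma expheat_sqr_ge f t x : 0 <= t -> bdd f ->
  expheat t f x ^+ 2 <= expheat t (f * f) x.
Proof.
move=> t0 bf; set c := expheat t f x; have bff := bddM bf bf.
have bc := @bdd_cst R V (c ^+ 2).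
have b2 : bdd (- (2 * c) *: f + (fun=> c ^+ 2)) by apply: bddD => //; exact: bddZ.
have := @expheat_ge0 (1 *: (f * f) + (- (2 * c) *: f + (fun=> c ^+ 2))) t t0.
rewrite !expheat_linear// expheat_cst => /(_ _ _ x).
rewrite !fctE /GRing.scale/= -/c => H; rewrite -subr_ge0.
apply: le_trans (H _ _) _; [by apply: bddD; [exact: bddZ|]| |].
  move=> y; have := sqr_ge0 (f y - c); congr (0 <= _).
  by rewrite ?fctE /GRing.scale/=; ring.
by rewrite le_eqVlt; apply/orP; left; apply/eqP; ring.
Qed.

End HeatFlow.

(** * Identification with the heat kernel *)

Lemma finite_set_enum {V : choiceType} (A : set V) : finite_set A ->
  exists n (p : 'I_n -> V), [/\ injective p, forall i, A (p i),
    forall x, A x -> exists i, x = p i &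
    forall (R : nmodType) (F : V -> R), \sum_(x \in A) F x = \sum_i F (p i)].
Proof.
move=> finA; pose s := in_tuple (finmap.enum_fset (fset_set A)).
have mem_s x : (x \in s) = (x \in A).
  by rewrite -(in_fset_set finA).
exists (size s), (tnth s); split.
- exact/tuple_uniqP/finmap.fset_uniq.
- by move=> i; apply/set_mem; rewrite -mem_s mem_tnth.
- by move=> x /mem_set; rewrite -mem_s => /tnthP.
- by move=> R F; rewrite fsbig_finite// big_tnth.
Qed.

(** * Balls as an exhaustion, and finite propagation of [gen] *)

Section Balls.
Context {R : realType} {V : choiceType} (G : weighted_graph R V) (x0 : V).
Implicit Types (f g : V -> R) (x y : V).

Fixpoint gball n : set V :=
  if n is m.+1 then gball m `|` \bigcup_(x in gball m) nbr G x else [set x0].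

Lemma gball_finite n : finite_set (gball n).
Proof.
elim: n => [|n IH] /=; first exact: finite_set1.
rewrite finite_setU; split=> //.
by apply: bigcup_finite => // x _; exact: locally_finite.
Qed.

Lemma gball_interior n : gball n `<=` ginterior G (gball n.+1).
Proof. by move=> x Bx; split=> [|y xy]; [left|right; exists x]. Qed.

Lemma gball_cover : \bigcup_n gball n = setT.
Proof.
rewrite -subTset => y _; have [p [+ <-]] := graph_connected G x0 y.
have : gball 0 x0 by [].
(* The induction on the path needs an arbitrary start in a ball of arbitrary radius; each edge
   raises the radius by one. *)
move: {1}0%N => n; elim: p (x0) n => [|z p IH] x n Bx /=; first by exists n.
move=> /andP[xz]; apply: (IH _ n.+1); right; exists x => //.
Qed.

Lemma gball_exhaustion : is_exhaustion G gball.
Proof.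
by split; [exact: gball_finite|exact: gball_interior|exact: gball_cover].
Qed.

Lemma eq_gen f g x : f x = g x -> (forall y, nbr G x y -> f y = g y) ->
  gen G f x = gen G g x.
Proof.
move=> fgx fg; rewrite !genE fgx; congr (_ * _ + _).
by apply: eq_big_seq => y; rewrite mem_nb => /fg ->.
Qed.

(** Each application of [gen] looks only one edge further. *)
Lemma eq_iter_gen k m f g x : gball m x ->
  (forall y, gball (m + k) y -> f y = g y) ->
  iter k (gen G) f x = iter k (gen G) g x.
Proof.
elim: k m x => [|k IH] m x Bx fg; first by apply: fg; rewrite addn0.
rewrite !iterS; apply: eq_gen => [|y xy]; apply: (IH m.+1).
- by left.
- by move=> z; rewrite addSnnS; exact: fg.
- by right; exists x.
- by move=> z; rewrite addSnnS; exact: fg.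
Qed.

Lemma sub_gball m n : (m <= n)%N -> gball m `<=` gball n.
Proof.
move=> /subnKC <-; elim: (n - m)%N => [|k IH]; first by rewrite addn0.
by rewrite addnS => x /IH; left.
Qed.

End Balls.

(** * Expansion of the heat flow over point masses *)

Section Kernel.
Context {R : realType} {V : choiceType} (G : weighted_graph R V).
Implicit Types (f g : V -> R) (x y : V).

Definition dlt y : V -> R := fun x => (x == y)%:R.

Lemma bdd_dlt y : bdd (dlt y).
Proof. by exists 1 => x; rewrite /dlt; case: eqP; rewrite ?normr1 ?normr0. Qed.

Lemma sum_dlt (s : seq V) f x : uniq s ->
  (\sum_(y <- s) f y *: dlt y) x = if x \in s then f x else 0.
Proof.
elim: s => [|z s IH] /=; first by rewrite big_nil.
move=> /andP[zs /IH E]; rewrite big_cons !fctE E /GRing.scale/= in_cons /dlt.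
case: eqP => [->|_]; first by rewrite (negbTE zs) mulr1 addr0.
by rewrite mulr0 add0r.
Qed.

Lemma expheat_sum_dlt (s : seq V) f t x :
  expheat G t (\sum_(y <- s) f y *: dlt y) x
  = \sum_(y <- s) expheat G t (dlt y) x * f y.
Proof.
have bs (r : seq V) : bdd (\sum_(y <- r) f y *: dlt y).
  elim: r => [|z r IH]; first by rewrite big_nil; exact: (bdd_cst 0).
  by rewrite big_cons; apply: bddD => //; apply/bddZ/bdd_dlt.
elim: s => [|z s IH]; first by rewrite !big_nil (expheat_cst _ 0).
rewrite !big_cons expheat_linear//; last exact: bdd_dlt.
by rewrite !fctE IH /GRing.scale/= mulrC.
Qed.

Local Open Scope ereal_scope.

(** For one inequality, a finite partial sum is the flow of [f] cut off to a finite set, which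
    positivity bounds by the flow of [f]. For the other, the first [n] terms of the power series at
    [x] only see [f] on the ball of radius [n], so they are bounded by the sum over that ball. *)
Lemma esum_expheat_dlt t f x : (0 <= t)%R -> bdd f -> (forall y, (0 <= f y)%R) ->
  \esum_(y in [set: V]) (expheat G t (dlt y) x * f y)%:E = (expheat G t f x)%:E.
Proof.
move=> t0 bf f0.
have q0 y : (0 <= expheat G t (dlt y) x)%R.
  by apply: expheat_ge0 => //; exact: bdd_dlt.
pose q y := (expheat G t (dlt y) x * f y)%:E.
have fsumq (A : set V) : finite_set A ->
    \sum_(y \in A) q y =
    (expheat G t (\sum_(y <- finmap.enum_fset (fset_set A)) f y *: dlt y)%R x)%:E.
  by move=> finA; rewrite fsbig_finite//= sumEFin expheat_sum_dlt.
have bddif (s : seq V) : uniq s -> bdd (\sum_(y <- s) f y *: dlt y)%R.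
  move=> us; have [C fC] := bf; exists C => z; rewrite sum_dlt//.
  by case: ifP => // _; rewrite normr0 (le_trans _ (fC z)).
have le1 : \esum_(y in [set: V]) q y <= (expheat G t f x)%:E.
  apply: ub_ereal_sup => _ [A [finA _] <-]; rewrite fsumq// lee_fin.
  apply: expheat_le => // [|y]; first by apply: bddif; exact: finmap.fset_uniq.
  by rewrite sum_dlt ?finmap.fset_uniq//; case: ifP.
have q_ge0 : 0 <= \esum_(y in [set: V]) q y.
  by apply: esum_ge0 => y _; rewrite lee_fin mulr_ge0.
have finE : \esum_(y in [set: V]) q y \is a fin_num.
  by rewrite ge0_fin_numE// (le_lt_trans le1)// ltry.
apply/eqP; rewrite eq_le le1/= -(fineK finE) lee_fin.
rewrite /expheat scalrfctE /GRing.scale/= mulrC -ler_pdivlMr ?expR_gt0//.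
apply: limr_le; first exact: exp_gen_is_cvg.
near=> n; rewrite ler_pdivlMr ?expR_gt0// -lee_fin fineK//.
pose s : seq V := finmap.enum_fset (fset_set (gball G x n)).
have us : uniq s by exact: finmap.fset_uniq.
have mem_s y : gball G x n y -> y \in s.
  by move=> By; rewrite /s in_fset_set ?inE//; exact: gball_finite.
apply: (@le_trans _ _ (\sum_(y \in gball G x n) q y)); last first.
  by apply: ereal_sup_ubound; exists (gball G x n) => //; split=> //; exact: gball_finite.
rewrite fsumq; last exact: gball_finite.
rewrite lee_fin /expheat scalrfctE /GRing.scale/= mulrC ler_wpM2l ?expR_ge0//.
rewrite [leLHS](_ : _ = pseries (exp_coef G (\sum_(y <- s) f y *: dlt y) x) t n)%R.
  apply: pseries_exp_coef_ge => //; last exact: bddif.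
  by move=> y; rewrite sum_dlt//; case: ifP.
rewrite /pseries /series/= big_nat_cond [RHS]big_nat_cond; apply: eq_bigr => k.
rewrite andbT => kn; rewrite /exp_coef; congr (_ * _ * _)%R.
apply: (@eq_iter_gen _ _ G x k 0) => // y By; rewrite sum_dlt// mem_s//.
by apply: sub_gball By; rewrite ltnW.
Unshelve. all: by end_near. Qed.

End Kernel.

(** * Eigenbases of the Dirichlet Laplacian *)

Section Eigenbasis.
Context {R : realType} {V : choiceType} (G : weighted_graph R V).
Implicit Types (f g : V -> R) (x y : V).

Lemma ginterior_finite U : finite_set U -> finite_set (ginterior G U).
Proof. by apply: sub_finite_set => x []. Qed.

Lemma sum_nb_dlt x z : \sum_(y <- nb G x) wt G x y * dlt z y = wt G x z.
Proof.
have un : uniq (nb G x) by exact: finmap.fset_uniq.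
have [zx|zx] := boolP (z \in nb G x).
  rewrite (bigD1_seq z)//= /dlt eqxx mulr1 big1 ?addr0// => y /negbTE ->.
  by rewrite mulr0.
rewrite big_seq big1 => [|y yx]; last first.
  by rewrite /dlt; case: eqP yx => [->|_ _]; [rewrite (negbTE zx)|rewrite mulr0].
by apply/esym/eqP; rewrite eq_le wt_ge0 leNgt -mem_nb zx.
Qed.

Lemma dirichlet_DeltaE U f x : l2_carrier G U f ->
  dirichlet_Delta G U f x = if x \in ginterior G U then Delta G f x else 0.
Proof.
move=> Uf; rewrite /dirichlet_Delta; congr (if _ then Delta G _ x else _).
apply/funext => y; case: ifPn => // /negP yU; rewrite Uf// => /mem_set.
exact: yU.
Qed.

(* In the orthonormal basis [dlt (p i) / sqrt (vol (p i))], the operator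
   [- dirichlet_Delta] has a symmetric matrix, which is diagonalized. *)
Lemma eigenbasis_exists U : finite_set U ->
  exists N (phi : 'I_N -> V -> R) (lam : 'I_N -> R), is_eigenbasis G U phi lam.
Proof.
move=> /ginterior_finite /finite_set_enum[N [p [p_inj Up pU sump]]].
pose r i := Num.sqrt (vol G (p i)).
have r2 i : r i ^+ 2 = vol G (p i) by rewrite sqr_sqrtr// ltW// vol_gt0.
have r_neq0 i : r i != 0 by rewrite gt_eqF// sqrtr_gt0 vol_gt0.
pose S : 'M[R]_N := \matrix_(i, j)
  ((r i)^-1 * (deg G (p i) *+ (i == j) - wt G (p i) (p j)) * (r j)^-1).
have [|Q [d [QQ QS]]] := @symmetric_diagonalization R N S.
  apply/matrixP => i j; rewrite !mxE wt_sym eq_sym.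
  by case: eqP => [->|_] /=; rewrite ?mulr1n ?mulr0n; ring.
(* [Q] is square, so its columns are orthonormal too; this makes the family [phi] complete. *)
have QTQ : Q^T *m Q = 1%:M by exact: mulmx1C.
pose phi k x := \sum_i dlt (p i) x * (Q k i / r i).
have phip k i : phi k (p i) = Q k i / r i.
  rewrite /phi (bigD1 i)//= {1}/dlt eqxx mul1r big1 ?addr0// => j ij.
  by rewrite /dlt (inj_eq p_inj) eq_sym (negbTE ij) mul0r.
have phi0 k : l2_carrier G U (phi k).
  move=> x Ux; rewrite /phi big1// => i _; rewrite /dlt.
  by case: eqP Ux => [-> /(_ (Up i))//|]; rewrite mul0r.
exists N, phi, (fun k => d 0 k); split=> //.
- move=> k l; rewrite /l2_dot sump.
  transitivity ((Q *m Q^T) k l); last by rewrite QQ mxE.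
  rewrite mxE; apply: eq_bigr => i _; rewrite !phip mxE -r2.
  by field; exact: r_neq0.
(* These coefficients are [l2_dot G U f (phi k)], because [vol G (p i) / r i = r i]. *)
- move=> f Uf; exists (fun k => \sum_i Q k i * (r i * f (p i))) => x.
  have [/pU[i ->]|Ux] := pselect (ginterior G U x); last first.
    by rewrite Uf// big1// => k _; rewrite phi0// mulr0.
  under eq_bigr do rewrite phip mulr_suml.
  rewrite exchange_big/=.
  transitivity (\sum_j (Q^T *m Q) j i * (r j * f (p j)) / r i).
    rewrite QTQ (bigD1 i)//= mxE eqxx mulr1n big1 ?addr0 => [|j ji].
      by field; exact: r_neq0.
    by rewrite mxE (negbTE ji) !mul0r.
  apply: eq_bigr => j _; rewrite mxE !mulr_suml; apply: eq_bigr => k _.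
  by rewrite mxE; ring.
- move=> k x; rewrite dirichlet_DeltaE//; case: ifPn => [/set_mem|/negP xU]; last first.
    by rewrite phi0 ?mulr0 ?oppr0// => /mem_set.
  move=> /pU[i ->]; rewrite DeltaE.
  have sumphi : \sum_(y <- nb G (p i)) wt G (p i) y * phi k y =
      \sum_j wt G (p i) (p j) * (Q k j / r j).
    rewrite /phi; under eq_bigr do rewrite mulr_sumr.
    rewrite exchange_big/=; apply: eq_bigr => j _.
    by rewrite -[in RHS]sum_nb_dlt mulr_suml; apply: eq_bigr => y _; rewrite mulrA.
  under eq_bigr do rewrite mulrBr.
  rewrite sumrB -mulr_suml -/(deg G (p i)) sumphi phip.
  (* Entry [(k, i)] of [QS] is the eigenvalue equation at [p i], up to the factor [1 / r i]. *)
  have /matrixP/(_ k i) := QS; rewrite mul_diag_mx [LHS]mxE [RHS]mxE => QSki.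
  rewrite [RHS]mulrA -QSki.
  have -> : \sum_j Q k j * S j i = (deg G (p i) * (Q k i / r i) -
      \sum_j wt G (p i) (p j) * (Q k j / r j)) / r i.
    transitivity (\sum_j ((deg G (p j) *+ (j == i)) * (Q k j / r j) -
        wt G (p i) (p j) * (Q k j / r j)) / r i).
      by apply: eq_bigr => j _; rewrite mxE wt_sym; ring.
    rewrite -mulr_suml sumrB (bigD1 i)//= eqxx big1 ?addr0// => j ji.
    by rewrite (negbTE ji) mul0r.
  by rewrite -r2; field; exact: r_neq0.
Qed.

End Eigenbasis.

(** * Dirichlet heat kernels and their limit along an exhaustion *)

Section DirichletKernel.
Context {R : realType} {V : choiceType} (G : weighted_graph R V).
Implicit Types (f g : V -> R) (x y : V) (U : set V).

(** Only the result is cut off, not the argument; on [l2_carrier G U] this is nevertheless the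
    Dirichlet Laplacian plus [rate]. *)
Definition dirichlet_gen U f x := if x \in ginterior G U then gen G f x else 0.

Lemma dirichlet_gen_ge0 U f x : (forall y, 0 <= f y) -> 0 <= dirichlet_gen U f x.
Proof. by move=> f0; rewrite /dirichlet_gen; case: ifP => // _; exact: gen_ge0. Qed.

Lemma dirichlet_gen_le U f g x : (forall y, 0 <= g y) ->
  (forall y, f y <= g y) -> dirichlet_gen U f x <= gen G g x.
Proof.
move=> g0 fg; rewrite /dirichlet_gen; case: ifP => _; first exact: gen_le.
exact: gen_ge0.
Qed.

Lemma iter_dirichlet_gen_ge0 U f k x : (forall y, 0 <= f y) ->
  0 <= iter k (dirichlet_gen U) f x.
Proof. by move=> f0; elim: k x => //= k IH x; exact: dirichlet_gen_ge0. Qed.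

Lemma iter_dirichlet_gen_le U f k x : (forall y, 0 <= f y) ->
  iter k (dirichlet_gen U) f x <= iter k (gen G) f x.
Proof.
move=> f0; elim: k x => //= k IH x; apply: dirichlet_gen_le => // y.
exact: iter_gen_ge0.
Qed.

Definition dirichlet_series U t x y : R^nat :=
  series (fun k => (k`!%:R)^-1 * iter k (dirichlet_gen U) (dlt y) x * t ^+ k).

Lemma dirichlet_gen_sum U (N : nat) (phi : 'I_N -> V -> R) (c : 'I_N -> R) x :
  dirichlet_gen U (fun x => \sum_i c i * phi i x) x =
  \sum_i c i * dirichlet_gen U (phi i) x.
Proof.
rewrite /dirichlet_gen; case: ifP => _; last by rewrite big1// => i _; rewrite mulr0.
have -> : (fun x => \sum_i c i * phi i x) = \sum_i c i *: phi i.
  by apply/funext => z; rewrite fct_sumE.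
elim/big_rec2: _ => [|i a h _ <-]; first by rewrite gen0.
by rewrite gen_linear.
Qed.

(** By orthonormality the [i]-th coefficient is [l2_dot G U (dlt y) (phi i)], a sum with the single
    term at [y]. *)
Lemma eigenbasis_dlt U (N : nat) (phi : 'I_N -> V -> R) (lam : 'I_N -> R) y x :
  finite_set U -> is_eigenbasis G U phi lam -> ginterior G U y ->
  dlt y x = \sum_i (vol G y * phi i y) * phi i x.
Proof.
move=> finU [phi0 phi_orth phi_span _] Uy.
have [|c dE] := phi_span (dlt y).
  by move=> z Uz; rewrite /dlt; case: eqP Uz => // ->.
rewrite dE; apply: eq_bigr => i _; congr (_ * _).
have finI := ginterior_finite G finU.
transitivity (l2_dot G U (dlt y) (phi i)).
  have -> : dlt y = fun x => \sum_j c j * phi j x by exact/funext.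
  transitivity (\sum_j c j * l2_dot G U (phi j) (phi i)).
    rewrite (bigD1 i)//= phi_orth eqxx mulr1 big1 ?addr0// => j ji.
    by rewrite phi_orth (negbTE ji) mulr0.
  rewrite /l2_dot !fsbig_finite//=.
  under eq_bigr do rewrite fsbig_finite//= mulr_sumr.
  rewrite exchange_big/=; apply: eq_bigr => z _.
  by rewrite mulr_sumr mulr_suml; apply: eq_bigr => j _; ring.
rewrite /l2_dot fsbig_finite// (bigD1_seq y)/= ?finmap.fset_uniq//; last first.
  by rewrite in_fset_set// inE.
rewrite /dlt eqxx mulr1 big1 ?addr0// => z /negbTE ->.
by rewrite mulr0 mul0r.
Qed.

Lemma iter_dirichlet_gen_dlt U (N : nat) (phi : 'I_N -> V -> R)
    (lam : 'I_N -> R) y x k :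
  finite_set U -> is_eigenbasis G U phi lam -> ginterior G U y ->
  iter k (dirichlet_gen U) (dlt y) x =
  \sum_i (vol G y * phi i y * (rate G - lam i) ^+ k) * phi i x.
Proof.
move=> finU basis Uy; elim: k x => [|k IH] x.
  rewrite /= (eigenbasis_dlt _ finU basis Uy); apply: eq_bigr => i _.
  by rewrite expr0 mulr1.
rewrite iterS (_ : iter k _ _ = fun x =>
  \sum_i (vol G y * phi i y * (rate G - lam i) ^+ k) * phi i x);
  last exact/funext.
rewrite dirichlet_gen_sum; apply: eq_bigr => i _.
have [phi0 _ _ phiE] := basis.
(* Eigenfunctions of the negative Laplacian for [lam i] are eigenfunctions of the shifted operator
   for [rate G - lam i]. *)
suff -> : dirichlet_gen U (phi i) x = (rate G - lam i) * phi i x.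
  by rewrite exprSr; ring.
have := phiE i x; rewrite dirichlet_DeltaE// /dirichlet_gen.
case: ifPn => [_|/negP xU _]; last by rewrite phi0 ?mulr0// => /mem_set.
rewrite /gen !fctE /GRing.scale/= => E; rewrite mulrBl -E; ring.
Qed.

(** In the eigenbasis chosen by [get] the series splits into finitely many exponential series at
    [(rate G - lam i) * t]. The factor [vol G y] appears because [dlt y] is not normalized by the
    measure. *)
Lemma cvg_dirichlet_series U t x y : finite_set U -> ginterior G U y ->
  dirichlet_series U t x y @ \oo -->
    expR (rate G * t) * (vol G y * dirichlet_heat_kernel G U t x y).
Proof.
move=> finU Uy; rewrite /dirichlet_heat_kernel.
have [N0 [phi0 [lam0 basis0]]] := eigenbasis_exists G finU.
set K := [set r | _].
have : K (get K).
  apply: getPex; exists (\sum_i expR (- lam0 i * t) * phi0 i x * phi0 i y).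
  by exists N0, phi0, lam0.
move=> [N [phi [lam [basis ->]]]].
rewrite !mulr_sumr.
have -> : dirichlet_series U t x y = fun n => \sum_i
    (vol G y * phi i y * phi i x) * series (exp_coeff ((rate G - lam i) * t)) n.
  apply/funext => n; rewrite /dirichlet_series /series/=.
  under [RHS]eq_bigr do rewrite mulr_sumr.
  rewrite exchange_big/=; apply: eq_bigr => k _.
  rewrite (iter_dirichlet_gen_dlt _ _ finU basis Uy) mulr_sumr mulr_suml.
  by apply: eq_bigr => i _; rewrite /exp_coeff/= exprMn; ring.
apply: cvg_big => [x'|i _]; first exact: add_continuous.
have -> : expR (rate G * t) * (vol G y * (expR (- lam i * t) * phi i x * phi i y)) =
    (vol G y * phi i y * phi i x) * expR ((rate G - lam i) * t).
  by rewrite mulrBl expRD mulNr; ring.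
by apply: cvgMl_tmp; exact: is_cvg_series_exp_coeff.
Qed.

Lemma near_ginterior (U : nat -> set V) x : is_exhaustion G U ->
  \forall k \near \oo, ginterior G (U k) x.
Proof.
move=> [_ UI cov]; have : (\bigcup_k U k) x by rewrite cov.
move=> [k _ Ukx]; exists k.+1 => // m /= /subnKC <-.
have {Ukx} : ginterior G (U k.+1) x by exact: UI.
elim: (m - k.+1)%N => [|j IH]; first by rewrite addn0.
by rewrite addnS => /IH[/UI]. 
Qed.

(** The iterate at [x] involves finitely many vertices, all of which are eventually interior, so the
    cut-off is eventually invisible. *)
Lemma near_iter_dirichlet_gen (U : nat -> set V) f j x : is_exhaustion G U ->
  \forall k \near \oo, iter j (dirichlet_gen (U k)) f x = iter j (gen G) f x.
Proof.
move=> exU; elim: j x => [|j IH] x; first by near=> k.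
have nbE : \forall k \near \oo, forall y, y \in nb G x ->
    iter j (dirichlet_gen (U k)) f y = iter j (gen G) f y.
  elim: (nb G x) => [|z s IHs]; first by near=> k.
  near=> k => y; rewrite in_cons => /orP[/eqP ->|]; first by near: k; exact: IH.
  by move: y; near: k.
near=> k; rewrite !iterS {1}/dirichlet_gen mem_set; last first.
  by near: k; exact: near_ginterior.
apply: eq_gen => [|y xy]; first by near: k; exact: IH.
have : y \in nb G x by rewrite mem_nb.
by move: y {xy}; near: k.
Unshelve. all: by end_near. Qed.

(** The rescaled kernels [e k] are squeezed: eventually they are at most the full series, by
    comparison of coefficients, and at least any prescribed partial sum of it. *)
Lemma cvg_dirichlet_heat_kernel (U : nat -> set V) t x y : 0 <= t ->
  is_exhaustion G U ->
  dirichlet_heat_kernel G (U k) t x y @[k --> \oo] -->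
    (vol G y)^-1 * expheat G t (dlt y) x.
Proof.
move=> t0 exU; have [finU _ _] := exU.
have d0 z : 0 <= dlt y z :> R by rewrite /dlt ler0n.
pose e k := expR (rate G * t) * (vol G y * dirichlet_heat_kernel G (U k) t x y).
suff ecvg : e k @[k --> \oo] --> exp_gen G t (dlt y) x.
  have -> : (fun k => dirichlet_heat_kernel G (U k) t x y) = fun k =>
      ((vol G y)^-1 * expR (- rate G * t)) * e k.
    apply/funext => k; rewrite /e mulNr expRN/=.
    by field; rewrite !gt_eqF ?expR_gt0 ?vol_gt0.
  rewrite /expheat scalrfctE /GRing.scale/= mulrA.
  exact: cvgMl_tmp.
have Scvg := @exp_gen_is_cvg _ _ G _ x t (bdd_dlt y).
have e_le : \forall k \near \oo, e k <= exp_gen G t (dlt y) x.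
  near=> k; have Uky : ginterior G (U k) y by near: k; exact: near_ginterior.
  have ek := @cvg_dirichlet_series _ t x y (finU k) Uky.
  rewrite -[e k](cvg_lim _ ek)//; apply: ler_lim => //.
    by apply/cvg_ex; eexists; exact: ek.
  near=> n; apply: ler_sum => i _; rewrite ler_wpM2r ?exprn_ge0//.
  by rewrite ler_wpM2l ?invr_ge0// iter_dirichlet_gen_le.
(* From some [k] on the first [J] coefficients of the two series agree, and the remaining Dirichlet
   terms are nonnegative. *)
have e_ge J : \forall k \near \oo, pseries (exp_coef G (dlt y) x) t J <= e k.
  have nearJ : \forall k \near \oo, forall j, (j < J)%N ->
      iter j (dirichlet_gen (U k)) (dlt y) x = iter j (gen G) (dlt y) x.
    elim: J => [|J IH]; first by near=> k.
    near=> k => j; rewrite ltnS leq_eqVlt => /orP[/eqP ->|].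
      by near: k; exact: near_iter_dirichlet_gen.
    by move: j; near: k.
  near=> k; have Uky : ginterior G (U k) y by near: k; exact: near_ginterior.
  have ek := @cvg_dirichlet_series _ t x y (finU k) Uky.
  have kJ : forall j, (j < J)%N ->
      iter j (dirichlet_gen (U k)) (dlt y) x = iter j (gen G) (dlt y) x by near: k.
  rewrite -[e k](cvg_lim _ ek)//.
  rewrite (_ : pseries _ _ _ = dirichlet_series (U k) t x y J).
    apply: nondecreasing_cvgn_le; last by apply/cvg_ex; eexists; exact: ek.
    apply: nondecreasing_series => i _ _.
    by rewrite mulr_ge0 ?exprn_ge0// mulr_ge0 ?invr_ge0// iter_dirichlet_gen_ge0.
  rewrite /pseries /dirichlet_series /series/= big_nat_cond [RHS]big_nat_cond.
  by apply: eq_bigr => j; rewrite andbT => jJ; rewrite kJ.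
apply/cvgrPdist_lt => eps eps0.
have [J _ HJ] : \forall n \near \oo,
    `|exp_gen G t (dlt y) x - pseries (exp_coef G (dlt y) x) t n| < eps.
  by move/cvgrPdist_lt : Scvg; exact.
near=> k; rewrite ger0_norm; last by rewrite subr_ge0; near: k.
apply: le_lt_trans (HJ J _); last by rewrite /=.
apply: le_trans (ler_norm _); rewrite lerD2l lerN2.
by near: k; exact: e_ge.
Unshelve. all: by end_near. Qed.

(** The common limit exists by [cvg_dirichlet_heat_kernel], so [get] returns one; it is read off
    along the balls around [x]. *)
Lemma heat_kernelE t x y : 0 <= t ->
  heat_kernel G t x y = (vol G y)^-1 * expheat G t (dlt y) x.
Proof.
move=> t0; rewrite /heat_kernel; set K := [set l | _].
have : K (get K).
  apply: getPex; exists ((vol G y)^-1 * expheat G t (dlt y) x) => U exU.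
  exact: cvg_dirichlet_heat_kernel.
move=> /(_ _ (gball_exhaustion G x)) /cvg_lim <- //.
apply/cvg_lim => //; apply: cvg_dirichlet_heat_kernel => //.
exact: gball_exhaustion.
Qed.

(** [esum_expheat_dlt] is applied to the positive and negative parts of [f], following [vertex_sum],
    and linearity recombines them. *)
Lemma heatE t f : 0 <= t -> bdd f -> heat G t f = expheat G t f.
Proof.
move=> t0 bf; apply/funext => x; rewrite /heat; case: eqP => [->|_].
  by rewrite expheat0.
rewrite /vertex_sum.
pose fp : V -> R := fun y => Num.max (f y) 0.
pose fn : V -> R := fun y => Num.max (- f y) 0.
have q0 y : 0 <= expheat G t (dlt y) x.
  by apply: expheat_ge0 => //; exact: bdd_dlt.
have maxM (a b : R) : 0 <= a -> Num.max (a * b) 0 = a * Num.max b 0.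
  by move=> a0; rewrite maxr_pMr// mulr0.
have bfp : bdd fp.
  have [C fC] := bf; exists C => y; rewrite /fp.
  by case: (leP (f y) 0); rewrite ?normr0 ?fC// (le_trans _ (fC y)).
have bfn : bdd fn.
  have [C fC] := bf; exists C => y; rewrite /fn.
  by case: (leP (- f y) 0); rewrite ?normr0 ?normrN ?fC// (le_trans _ (fC y)).
have kE y : vol G y * heat_kernel G t x y * f y = expheat G t (dlt y) x * f y.
  by rewrite heat_kernelE// mulrA mulfV ?mul1r// gt_eqF// vol_gt0.
have -> : \esum_(y in [set: V]) (Num.max (vol G y * heat_kernel G t x y * f y) 0)%:E =
    (expheat G t fp x)%:E.
  rewrite -esum_expheat_dlt//; last by move=> y; rewrite /fp le_max lexx orbT.
  by apply: eq_esum => y _; rewrite kE maxM.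
have -> : \esum_(y in [set: V]) (Num.max (- (vol G y * heat_kernel G t x y * f y)) 0)%:E =
    (expheat G t fn x)%:E.
  rewrite -esum_expheat_dlt//; last by move=> y; rewrite /fn le_max lexx orbT.
  by apply: eq_esum => y _; rewrite kE -mulrN maxM.
rewrite /= -[LHS]/((expheat G t fp - expheat G t fn) x) -expheatB//.
congr (expheat G t _ x); apply/funext => y; rewrite !fctE /fp /fn.
by case: (leP (f y) 0); case: (leP (- f y) 0); lra.
Qed.

End DirichletKernel.

(** * Curvature and gradient bounds *)

Section SegmentIntegral.
Context {R : realType}.
Implicit Types (f g F : R -> R) (t : R).

Lemma Rintegral_is_derive F f t : 0 <= t ->
  (forall z : R, is_derive z 1 F (f z)) -> continuous f ->
  \int[lebesgue_measure]_(s in `[0, t]) f s = F t - F 0.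
Proof.
(* The interval reduced to a point is treated apart, since [continuous_FTC2] asks for distinct
   endpoints. *)
move=> t0 dF cf; move: t0; rewrite le_eqVlt => /predU1P[<-|t0].
  by rewrite set_itv1 Rintegral_set1 subrr.
have cF : continuous F by move=> z; exact: is_derive_continuous (dF z).
rewrite /Rintegral (@continuous_FTC2 _ _ F)//.
- exact: continuous_subspaceT.
- split; first by move=> z _; exact: (@ex_derive _ _ _ _ _ _ _ (dF z)).
    by apply: cvg_at_right_filter; exact: cF.
  by apply: cvg_at_left_filter; exact: cF.
- by move=> z _; rewrite derive1E; exact: (@derive_val _ _ _ _ _ _ _ (dF z)).
Qed.

Lemma le_Rintegral_segment f g t : continuous f -> continuous g ->
  (forall s, 0 <= s <= t -> f s <= g s) ->
  \int[lebesgue_measure]_(s in `[0, t]) f s <=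
  \int[lebesgue_measure]_(s in `[0, t]) g s.
Proof.
move=> cf cg fg; apply: le_Rintegral => //.
- apply: continuous_compact_integrable; first exact: segment_compact.
  exact: continuous_subspaceT.
- apply: continuous_compact_integrable; first exact: segment_compact.
  exact: continuous_subspaceT.
Qed.

End SegmentIntegral.

(** * The quotients of the statement and their derivatives *)

Section Quotients.
Context {R : realType} (K : R).
Implicit Types t s z : R.

(** [quot1] and [quot3] are the integrals from 0 of [2 e^(2Ks)] and [2 e^(-2Ks)]; [quot2] and
    [quot4] are those of [2 quot1] and [2 quot3]. This description includes [K = 0], so later proofs
    use only values at 0 and derivatives. *)
Definition quot1 t := quot_lim K ((expR (2 * K * t) - 1) / K) (2 * t).
Definition quot2 t :=
  quot_lim K ((expR (2 * K * t) - 1 - 2 * K * t) / K ^+ 2) (2 * t ^+ 2).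
Definition quot3 t := quot_lim K ((1 - expR (- 2 * K * t)) / K) (2 * t).
Definition quot4 t :=
  quot_lim K ((expR (- 2 * K * t) - 1 + 2 * K * t) / K ^+ 2) (2 * t ^+ 2).

Lemma quot_at0 : [/\ quot1 0 = 0, quot2 0 = 0, quot3 0 = 0 & quot4 0 = 0].
Proof.
rewrite /quot1 /quot2 /quot3 /quot4 /quot_lim; case: ifP => _;
  by rewrite !mulr0 ?expR0 ?expr0n/= ?(subrr, subr0, add0r, addr0, mulr0, mul0r).
Qed.

Lemma is_derive_expRM (a z : R) :
  is_derive z 1 (fun z => expR (a * z)) (a * expR (a * z)).
Proof. by apply: is_derive_eq; rewrite /GRing.scale/=; ring. Qed.

Lemma is_derive_quot1 z : is_derive z 1 quot1 (2 * expR (2 * K * z)).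
Proof.
rewrite /quot1 /quot_lim; case: eqP => [->|/eqP K0].
  by rewrite mulr0 mul0r expR0; apply: is_derive_eq; rewrite /GRing.scale/=; ring.
have dE := is_derive_expRM (2 * K) z.
by apply: is_derive_eq; rewrite /GRing.scale/=; field.
Qed.

Lemma is_derive_quot2 z : is_derive z 1 quot2 (2 * quot1 z).
Proof.
rewrite /quot2 /quot1 /quot_lim; case: eqP => [_|/eqP K0].
  by apply: is_derive_eq; rewrite /GRing.scale/=; ring.
have dE := is_derive_expRM (2 * K) z.
by apply: is_derive_eq; rewrite /GRing.scale/=; field.
Qed.

Lemma is_derive_quot3 z : is_derive z 1 quot3 (2 * expR (- 2 * K * z)).
Proof.
rewrite /quot3 /quot_lim; case: eqP => [->|/eqP K0].
  by rewrite mulr0 mul0r expR0; apply: is_derive_eq; rewrite /GRing.scale/=; ring.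
have dE := is_derive_expRM (- 2 * K) z.
by apply: is_derive_eq; rewrite /GRing.scale/=; field.
Qed.

Lemma is_derive_quot4 z : is_derive z 1 quot4 (2 * quot3 z).
Proof.
rewrite /quot4 /quot3 /quot_lim; case: eqP => [_|/eqP K0].
  by apply: is_derive_eq; rewrite /GRing.scale/=; ring.
have dE := is_derive_expRM (- 2 * K) z.
by apply: is_derive_eq; rewrite /GRing.scale/=; field.
Qed.

Lemma quot1_ge0 t : 0 <= t -> 0 <= quot1 t.
Proof.
move=> t0; have [<- _ _ _] := quot_at0.
apply: (nondecreasing_is_derive is_derive_quot1 t0) => z _.
by rewrite mulr_ge0// expR_ge0.
Qed.

Lemma quot31 t : quot3 t = expR (- 2 * K * t) * quot1 t.
Proof.
rewrite /quot3 /quot1 /quot_lim; case: eqP => [->|_].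
  by rewrite mulr0 mul0r expR0 mul1r.
rewrite mulrA mulrBr mulr1 -expRD -!mulrA mulNr addNr expR0; ring.
Qed.

End Quotients.

(** * Derivatives of the gradient form and of the square along the flow *)

Section GammaCalculus.
Context {R : realType} {V : choiceType} (G : weighted_graph R V).
Implicit Types (f g h : V -> R) (x y : V) (t s : R) (u : R -> V -> R).
Notation P := (expheat G).
Notation D := (Delta G).

Lemma sqr_funE f : (fun y => f y ^+ 2) = f * f.
Proof. by apply/funext => y; rewrite expr2. Qed.

Lemma DeltaN f : D (- f) = - D f.
Proof.
apply/funext => x; rewrite -[- f]addr0 -scaleN1r Delta_linear.
by rewrite (_ : D 0 = 0) ?addr0 ?scaleN1r//; exact: (Delta_cst G 0).
Qed.

Lemma Gamma_bilNl f g : Gamma_bil G (- f) g = - Gamma_bil G f g.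
Proof.
rewrite !Gamma_bilE mulNr !DeltaN.
by apply/funext => x; rewrite !fctE /GRing.scale/=; ring.
Qed.

Lemma DeltaM f g : D (f * g) = f * D g + g * D f + 2 *: Gamma_bil G f g.
Proof.
by rewrite Gamma_bilE; apply/funext => x; rewrite !fctE /GRing.scale/=; field.
Qed.

Lemma Gamma2E f : Gamma2 G f =
  2^-1 *: (D (Gamma G f) - Gamma_bil G f (D f) - Gamma_bil G (D f) f).
Proof. by apply/funext => x; rewrite /Gamma2 /Gamma2_bil mulrC. Qed.

Lemma Delta_Gamma f :
  D (Gamma G f) = 2 *: Gamma2 G f + 2 *: Gamma_bil G f (D f).
Proof.
rewrite Gamma2E (Gamma_bilC _ (D f) f).
by apply/funext => x; rewrite !fctE /GRing.scale/=; field.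
Qed.

Lemma bdd_Gamma f : bdd f -> bdd (Gamma G f).
Proof. by move=> bf; exact: bdd_Gamma_bil. Qed.

Lemma bdd_Gamma2 f : bdd f -> bdd (Gamma2 G f).
Proof.
move=> bf; have bDf := bdd_Delta G bf; rewrite Gamma2E; apply: bddZ.
have b1 := bdd_Gamma_bil G bf bDf; have b2 := bdd_Gamma_bil G bDf bf.
by apply: bddB b2; apply: bddB b1; apply/bdd_Delta/bdd_Gamma.
Qed.

(** The derivative is left unspecified: only the resulting continuity in [s] is used, for
    integration. *)
Lemma uderiv_Gamma2 u s f : uderiv u s f ->
  exists g, uderiv (fun s => Gamma2 G (u s)) s g.
Proof.
move=> du; have dDu := uderiv_Delta G du.
have := uderivZ 2^-1 (uderivB (uderivB (uderiv_Delta G (uderiv_Gamma_bil G du du))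
  (uderiv_Gamma_bil G du dDu)) (uderiv_Gamma_bil G dDu du)).
set g := (X in uderiv _ _ X) => dg; exists g; move: dg.
by congr uderiv; apply/funext => z; rewrite Gamma2E.
Qed.

Lemma is_derive_uderiv u s f x : uderiv u s f ->
  is_derive s 1 (fun s => u s x) (f x).
Proof. by move=> [_ _ [C HC]]; apply: is_derive_quadratic => k; exact: HC. Qed.

Lemma uderiv_expheat_id f s : bdd f -> uderiv (fun s => P s f) s (P s (D f)).
Proof.
move=> bf; split; [by move=> z; exact: bdd_expheat| |exact: expheat_taylor].
by apply/bdd_expheat/bdd_Delta.
Qed.

(** With [g] the flow of [f] at time [t - s], the two contributions combine to
    [D (Gamma g) - 2 Gamma(g, D g)], which is [2 Gamma2 g]. *)
Lemma is_derive_Gamma_flow f t s x : bdd f ->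
  is_derive s 1 (fun s => P s (Gamma G (P (t - s) f)) x)
    (2 * P s (Gamma2 G (P (t - s) f)) x).
Proof.
move=> bf; have du := uderiv_expheat G t s bf.
have bg := bdd_expheat G (t - s) bf; set g := P (t - s) f in bg *.
have := is_derive_expheat_curve G x (uderiv_Gamma_bil G du du).
rewrite -/g (Gamma_bilC _ g (- _)) Gamma_bilNl.
have bDg := bdd_Delta G bg.
have bGgD := bdd_Gamma_bil G bg bDg.
rewrite -[_ x + _ x]/((P s _ + P s _) x).
rewrite -expheatD; last 2 first.
- by apply/bdd_Delta/bdd_Gamma.
- by apply: bddD; apply/bddN/bdd_Gamma_bil.
rewrite (_ : D _ + _ = 2 *: Gamma2 G g); last first.
  rewrite -/(Gamma G g) Delta_Gamma (Gamma_bilC _ (D g)); apply/funext => y.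
  by rewrite !fctE /GRing.scale/=; ring.
by rewrite expheatZ//; exact: bdd_Gamma2.
Qed.

(** Here the contributions combine to [D (g g) - 2 g D g], which is [2 Gamma g]. *)
Lemma is_derive_sqr_flow f t s x : bdd f ->
  is_derive s 1 (fun s => P s (P (t - s) f * P (t - s) f) x)
    (2 * P s (Gamma G (P (t - s) f)) x).
Proof.
move=> bf; have du := uderiv_expheat G t s bf.
have bg := bdd_expheat G (t - s) bf; set g := P (t - s) f in bg *.
have := is_derive_expheat_curve G x (uderivM du du).
rewrite -/g.
have bDg := bdd_Delta G bg.
rewrite -[_ x + _ x]/((P s _ + P s _) x).
rewrite -expheatD; last 2 first.
- by apply/bdd_Delta/bddM.
- by apply: bddD; apply: bddM => //; exact: bddN.
rewrite (_ : D _ + _ = 2 *: Gamma G g); last first.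
  by rewrite DeltaM; apply/funext => y; rewrite !fctE /GRing.scale/=; ring.
by rewrite expheatZ//; exact: bdd_Gamma.
Qed.

End GammaCalculus.

(** * From the curvature condition to the four inequalities *)

Section CurvatureImpliesGradientBounds.
Context {R : realType} {V : choiceType} (G : weighted_graph R V) (n K : R).
Hypotheses (n_gt0 : 0 < n) (cd : CD G n (- K)).
Implicit Types (f g : V -> R) (x y : V) (t s : R).
Notation P := (expheat G).
Notation D := (Delta G).

(** The curvature condition for the flow at time [t - s], averaged by the positive operator
    [P s]. *)
Lemma expheat_Gamma2_ge f t s x : bdd f -> 0 <= s ->
  n^-1 * P s (P (t - s) (D f) * P (t - s) (D f)) x
    - K * P s (Gamma G (P (t - s) f)) x <= P s (Gamma2 G (P (t - s) f)) x.
Proof.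
move=> bf s0; have bg := bdd_expheat G (t - s) bf.
rewrite -Delta_expheat//; set g := P (t - s) f in bg *.
have bDg := bdd_Delta G bg; have bDg2 := bddM bDg bDg.
have bGg := bdd_Gamma G bg.
rewrite -mulNr [leLHS](_ : _ = P s (n^-1 *: (D g * D g) + (- K) *: Gamma G g) x).
  apply: expheat_le => //.
- by apply: bddD; exact: bddZ.
- exact: bdd_Gamma2.
- by move=> y; have := cd g y; rewrite expr2.
by rewrite expheat_linear// ?expheatZ//; exact: bddZ.
Qed.

Lemma expheat_sqr_flow_ge f t s x : bdd f -> 0 <= s ->
  P t f x ^+ 2 <= P s (P (t - s) f * P (t - s) f) x.
Proof.
move=> bf s0; rewrite -(expheat_semigroup G s t bf).
by apply: expheat_sqr_ge => //; exact: bdd_expheat.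
Qed.

Lemma is_derive_weighted_Gamma_flow f t s x : bdd f ->
  is_derive s 1 (fun s => expR (2 * K * s) * P s (Gamma G (P (t - s) f)) x)
    (2 * expR (2 * K * s) * (K * P s (Gamma G (P (t - s) f)) x
      + P s (Gamma2 G (P (t - s) f)) x)).
Proof.
move=> bf; have dE := is_derive_expRM (2 * K) s.
have dG := is_derive_Gamma_flow G t s x bf.
by apply: is_derive_eq; rewrite /GRing.scale/=; ring.
Qed.

(** [F] runs from the left side at [s = 0] to the first term on the right at [s = t]. By
    [expheat_Gamma2_ge], [n / 2] times its derivative dominates the integrand [g], and the
    inequality is integrated. *)
Lemma gradient_bound_integral f t x : 0 <= t -> bdd f ->
  Gamma G (P t f) x <= expR (2 * K * t) * P t (Gamma G f) x
    - 2 / n * \int[lebesgue_measure]_(s in `[0, t])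
        (expR (2 * K * s) * P s (P (t - s) (D f) * P (t - s) (D f)) x).
Proof.
move=> t0 bf; have bDf := bdd_Delta G bf.
pose F s := expR (2 * K * s) * P s (Gamma G (P (t - s) f)) x.
pose F1 s := 2 * expR (2 * K * s) * (K * P s (Gamma G (P (t - s) f)) x
      + P s (Gamma2 G (P (t - s) f)) x).
pose g s := expR (2 * K * s) * P s (P (t - s) (D f) * P (t - s) (D f)) x.
have dF (z : R) : is_derive z 1 (fun z => n / 2 * F z) (n / 2 * F1 z).
  have := is_derive_weighted_Gamma_flow t z x bf; rewrite -/(F1 z) => dF.
  by apply: is_derive_eq; rewrite /GRing.scale/=.
have contE : continuous (fun s => expR (2 * K * s)).
  by move=> z; exact: is_derive_continuous (is_derive_expRM _ z).
have cg : continuous g.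
  move=> z; apply: cvgM; first exact: contE.
  exact: is_derive_continuous (is_derive_sqr_flow G t z x bDf).
have cF1 : continuous (fun z => n / 2 * F1 z).
  move=> z; apply: cvgMl_tmp; apply: cvgM; first by apply: cvgMl_tmp; exact: contE.
  apply: cvgD.
    apply: cvgMl_tmp.
    exact: is_derive_continuous (is_derive_Gamma_flow G t z x bf).
  have [h dh] := uderiv_Gamma2 G (uderiv_expheat G t z bf).
  exact: is_derive_continuous (is_derive_expheat_curve G x dh).
have : \int[lebesgue_measure]_(s in `[0, t]) g s <= n / 2 * F t - n / 2 * F 0.
  rewrite -(Rintegral_is_derive t0 dF cF1).
  apply: le_Rintegral_segment => // s /andP[s0 st].
  rewrite /g /F1 -[leRHS](_ : expR (2 * K * s) * (n * (K * P s (Gamma G (P (t - s) f)) x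
      + P s (Gamma2 G (P (t - s) f)) x)) = _); last by field.
  rewrite ler_wpM2l ?expR_ge0// -ler_pdivrMl//.
  by have := expheat_Gamma2_ge t x bf s0; lra.
rewrite /F subr0 subrr mulr0 expR0 mul1r !expheat0//; last first.
  by apply/bdd_Gamma/bdd_expheat.
set I := \int[_]_(s in _) _ => HI; rewrite lerBrDr -lerBrDl.
have n2 : 0 < 2 / n by rewrite divr_gt0.
have := ler_wpM2l (ltW n2) HI.
rewrite -mulrBr mulrA (_ : 2 / n * (n / 2) = 1) ?mul1r//.
by field; rewrite gt_eqF.
Qed.

(** The weighted flow minus [quot1 K s / n * q] is nondecreasing in [s]: its derivative is
    nonnegative by the curvature condition and Jensen's inequality. *)
Lemma gradient_bound f t x : 0 <= t -> bdd f ->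
  Gamma G (P t f) x <= expR (2 * K * t) * P t (Gamma G f) x
    - quot1 K t / n * P t (D f) x ^+ 2.
Proof.
move=> t0 bf; have bDf := bdd_Delta G bf; set q := P t (D f) x ^+ 2.
have dF (z : R) : is_derive z 1 (fun s =>
    expR (2 * K * s) * P s (Gamma G (P (t - s) f)) x - quot1 K s / n * q)
    (2 * expR (2 * K * z) * (K * P z (Gamma G (P (t - z) f)) x
      + P z (Gamma2 G (P (t - z) f)) x - n^-1 * q)).
  have dw := is_derive_weighted_Gamma_flow t z x bf.
  have dq := is_derive_quot1 K z.
  by apply: is_derive_eq; rewrite /GRing.scale/=; ring.
have := nondecreasing_is_derive dF t0.
have [q10 _ _ _] := quot_at0 K.
rewrite subr0 subrr mulr0 expR0 mul1r q10 !mul0r subr0 !expheat0//; last first.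
  by apply/bdd_Gamma/bdd_expheat.
apply=> s /andP[s0 st]; rewrite mulr_ge0 ?mulr_ge0 ?expR_ge0//.
have := expheat_Gamma2_ge t x bf s0.
have := ler_wpM2l (ltW (etrans (invr_gt0 n) n_gt0)) (expheat_sqr_flow_ge t x bDf s0).
rewrite -/q; lra.
Qed.

(** The inequality compares the endpoint values of a function of [s] whose derivative is nonnegative
    by [gradient_bound] at time [t - s], averaged by [P s], and Jensen's inequality. *)
Lemma variance_upper_bound f t x : 0 <= t -> bdd f ->
  P t (f * f) x - P t f x ^+ 2 <= quot1 K t * P t (Gamma G f) x
    - quot2 K t / n * P t (D f) x ^+ 2.
Proof.
move=> t0 bf; have bDf := bdd_Delta G bf; set q := P t (D f) x ^+ 2.
have bGf := bdd_Gamma G bf.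
have dF (z : R) : is_derive z 1 (fun s => quot2 K (t - s) / n * q
    - quot1 K (t - s) * P t (Gamma G f) x - P s (P (t - s) f * P (t - s) f) x)
    (2 * expR (2 * K * (t - z)) * P t (Gamma G f) x - 2 * quot1 K (t - z) / n * q
     - 2 * P z (Gamma G (P (t - z) f)) x).
  have dsub : is_derive z 1 (fun s => t - s) (-1).
    by have := is_deriveB (is_derive_cst t z 1) (is_derive_id z (1 : R)); rewrite sub0r.
  have dq1 : is_derive z 1 (fun s => quot1 K (t - s)) (- (2 * expR (2 * K * (t - z)))).
    have dq := is_derive_quot1 K (t - z).
    have := @is_derive1_comp _ (quot1 K) (fun s => t - s) z _ _ dq dsub.
    by rewrite mulrN1.
  have dq2 : is_derive z 1 (fun s => quot2 K (t - s)) (- (2 * quot1 K (t - z))).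
    have dq := is_derive_quot2 K (t - z).
    have := @is_derive1_comp _ (quot2 K) (fun s => t - s) z _ _ dq dsub.
    by rewrite mulrN1.
  have ds := is_derive_sqr_flow G t z x bf.
  by apply: is_derive_eq; rewrite /GRing.scale/=; ring.
have := nondecreasing_is_derive dF t0.
have [q10 q20 _ _] := quot_at0 K.
rewrite subr0 subrr q10 q20 !mul0r subr0 !expheat0//; last first.
  by apply: bddM; exact: bdd_expheat.
rewrite -[(P t f * P t f) x]/(P t f x * P t f x) -expr2 => H.
suff /H : forall z, 0 <= z <= t ->
    0 <= 2 * expR (2 * K * (t - z)) * P t (Gamma G f) x
      - 2 * quot1 K (t - z) / n * q - 2 * P z (Gamma G (P (t - z) f)) x by lra.
move=> s /andP[s0 st]; have ts0 : 0 <= t - s by rewrite subr_ge0.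
have bP := bdd_expheat G (t - s) bDf; have bP2 := bddM bP bP.
have bPG := bdd_expheat G (t - s) bGf.
have gb : P s (Gamma G (P (t - s) f)) x <=
    expR (2 * K * (t - s)) * P t (Gamma G f) x
    - quot1 K (t - s) / n * P s (P (t - s) (D f) * P (t - s) (D f)) x.
  rewrite -mulNr -(expheat_semigroup G s t bGf).
  rewrite [leRHS](_ : _ = P s (expR (2 * K * (t - s)) *: P (t - s) (Gamma G f)
    + - (quot1 K (t - s) / n) *: (P (t - s) (D f) * P (t - s) (D f))) x).
    apply: expheat_le => //.
    - exact/bdd_Gamma/bdd_expheat.
    - by apply: bddD; exact: bddZ.
    - by move=> y; have := gradient_bound y ts0 bf; rewrite expr2 -mulNr.
  by rewrite (expheat_linear G _ _ bPG (bddZ _ bP2)) expheatZ.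
have c0 : 0 <= quot1 K (t - s) / n by rewrite divr_ge0 ?quot1_ge0// ltW.
have := ler_wpM2l c0 (expheat_sqr_flow_ge t x bDf s0).
rewrite -/q; lra.
Qed.

(** Again a comparison of endpoint values, now with [gradient_bound] at time [s] for the flow of [f]
    at time [t - s], so that the semigroup law produces [P t f]. *)
Lemma variance_lower_bound f t x : 0 <= t -> bdd f ->
  quot3 K t * Gamma G (P t f) x + quot4 K t / n * P t (D f) x ^+ 2 <=
  P t (f * f) x - P t f x ^+ 2.
Proof.
move=> t0 bf; have bDf := bdd_Delta G bf; set q := P t (D f) x ^+ 2.
have dF (z : R) : is_derive z 1 (fun s => P s (P (t - s) f * P (t - s) f) x
    - quot3 K s * Gamma G (P t f) x - quot4 K s / n * q)
    (2 * P z (Gamma G (P (t - z) f)) x -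
      2 * expR (- 2 * K * z) * Gamma G (P t f) x - 2 * quot3 K z / n * q).
  have dq3 := is_derive_quot3 K z; have dq4 := is_derive_quot4 K z.
  have ds := is_derive_sqr_flow G t z x bf.
  by apply: is_derive_eq; rewrite /GRing.scale/=; ring.
have := nondecreasing_is_derive dF t0.
have [_ _ q30 q40] := quot_at0 K.
rewrite subr0 subrr q30 q40 !mul0r !subr0 !expheat0//; last first.
  by apply: bddM; exact: bdd_expheat.
rewrite -[(P t f * P t f) x]/(P t f x * P t f x) -expr2 => H.
suff /H : forall z, 0 <= z <= t -> 0 <= 2 * P z (Gamma G (P (t - z) f)) x -
      2 * expR (- 2 * K * z) * Gamma G (P t f) x - 2 * quot3 K z / n * q by lra.
move=> s /andP[s0 st].
have := gradient_bound x s0 (bdd_expheat G (t - s) bf).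
rewrite expheat_semigroup// Delta_expheat// expheat_semigroup// -/q => gb.
have e0 : 0 <= expR (- 2 * K * s) by exact: expR_ge0.
(* Multiplying [gb] by [e^(-2Ks)] isolates the averaged gradient and turns [quot1] into [quot3]. *)
have e1 : expR (- 2 * K * s) * (expR (2 * K * s) * P s (Gamma G (P (t - s) f)) x)
    = P s (Gamma G (P (t - s) f)) x.
  by rewrite mulrA -expRD -!mulrA mulNr addNr expR0 mul1r.
have := ler_wpM2l e0 gb; rewrite mulrBr e1 quot31; lra.
Qed.

End CurvatureImpliesGradientBounds.

(** * Locality and the reduction to positive bounded functions *)

Section Locality.
Context {R : realType} {V : choiceType} (G : weighted_graph R V).
Implicit Types (f g : V -> R) (x y : V).

Lemma Gamma_bil_sumE f g x : Gamma_bil G f g x =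
  (2 * vol G x)^-1 * \sum_(y <- nb G x) wt G x y * ((f y - f x) * (g y - g x)).
Proof.
rewrite Gamma_bilE !fctE /GRing.scale/= !DeltaE invfM -mulrA; congr (_ * _).
rewrite !(mulrCA _ (vol G x)^-1) -!mulrBr; congr (_ * _).
rewrite !mulr_sumr -!sumrB; apply: eq_bigr => y _; ring.
Qed.

Lemma eq_Delta_shift f g c x : g x = f x + c ->
  (forall y, nbr G x y -> g y = f y + c) -> Delta G g x = Delta G f x.
Proof.
move=> gx gE; rewrite !DeltaE; congr (_ * _); apply: eq_big_seq => y.
by rewrite mem_nb => /gE ->; rewrite gx; congr (_ * _); ring.
Qed.

Lemma eq_Gamma_bil_shift f f' g g' c c' x : f' x = f x + c ->
  (forall y, nbr G x y -> f' y = f y + c) -> g' x = g x + c' ->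
  (forall y, nbr G x y -> g' y = g y + c') ->
  Gamma_bil G f' g' x = Gamma_bil G f g x.
Proof.
move=> fx fE gx gE; rewrite !Gamma_bil_sumE; congr (_ * _).
apply: eq_big_seq => y; rewrite mem_nb => xy.
by rewrite fx gx (fE _ xy) (gE _ xy); congr (_ * _); ring.
Qed.

(** Near [x], [Delta] and [Gamma] are unchanged by the shift, and [Gamma2] evaluates them only at
    [x] and its neighbours. *)
Lemma eq_Gamma2_shift f g c x : (forall y, gball G x 2 y -> g y = f y + c) ->
  Gamma2 G g x = Gamma2 G f x.
Proof.
move=> gE; have B0 : gball G x 0 x by [].
have B1 : gball G x 1 x by left.
have Bnb y : nbr G x y -> gball G x 1 y by move=> xy; right; exists x.
have DE y : gball G x 1 y -> Delta G g y = Delta G f y + 0.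
  move=> By; rewrite addr0; apply: (@eq_Delta_shift _ _ c); first by apply: gE; left.
  by move=> z yz; apply: gE; right; exists y.
have GE y : gball G x 1 y -> Gamma G g y = Gamma G f y + 0.
  move=> By; rewrite addr0.
  by apply: (@eq_Gamma_bil_shift _ _ _ _ c c);
    do ?[move=> z yz]; apply: gE; [left|right; exists y|left|right; exists y].
have gE1 y : gball G x 1 y -> g y = f y + c by move=> By; apply: gE; left.
have E1 : Gamma_bil G g (Delta G g) x = Gamma_bil G f (Delta G f) x.
  by apply: (@eq_Gamma_bil_shift _ _ _ _ c 0) => [|y /Bnb||y /Bnb];
    [exact: gE1|exact: gE1|exact: DE|exact: DE].
have E2 : Delta G (Gamma G g) x = Delta G (Gamma G f) x.
  by apply: (@eq_Delta_shift _ _ 0) => [|y /Bnb]; exact: GE.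
by rewrite !Gamma2E !fctE !(Gamma_bilC _ (Delta G _)) E1 E2.
Qed.

Lemma CD_pos_bounded n K :
  (forall f x, pos_bounded f ->
    n^-1 * Delta G f x ^+ 2 + K * Gamma G f x <= Gamma2 G f x) ->
  CD G n K.
Proof.
move=> H f x; pose s : seq V := finmap.enum_fset (fset_set (gball G x 2)).
have mem_s y : (y \in s) = (y \in gball G x 2).
  by rewrite /s in_fset_set//; exact: gball_finite.
pose C := \sum_(y <- s) `|f y|.
have fC y : y \in s -> `|f y| <= C.
  move=> ys; rewrite /C (bigD1_seq y)//= ?finmap.fset_uniq//.
  by rewrite lerDl sumr_ge0.
have C0 : 0 <= C by rewrite sumr_ge0.
(* [C] bounds [f] on the ball of radius 2, so the shift by [C + 1] is positive there. *)
pose g y := if y \in s then f y + (C + 1) else 1.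
have pg : pos_bounded g.
  split=> [y|].
    rewrite /g; case: ifP => [/fC|//]; rewrite ler_norml => /andP[+ _]; lra.
  apply: bdd_bounded_fun; exists (2 * C + 1) => y; rewrite /g.
  case: ifP => [/fC fy|_]; last by rewrite normr1; lra.
  by move: fy; rewrite !ler_norml => /andP[? ?]; apply/andP; split; lra.
have gE y : gball G x 2 y -> g y = f y + (C + 1).
  by move=> By; rewrite /g mem_s mem_set.
have gx : g x = f x + (C + 1) by apply: gE; left; left.
have gnb y : nbr G x y -> g y = f y + (C + 1).
  by move=> xy; apply: gE; left; right; exists x.
have := H g x pg; rewrite (eq_Gamma2_shift gE) (eq_Delta_shift gx gnb).
by rewrite (_ : Gamma G g x = Gamma G f x)//; exact: (eq_Gamma_bil_shift gx gnb gx gnb).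
Qed.

End Locality.

(** * From the inequalities back to curvature, by expansion at time 0 *)

Section Converses.
Context {R : realType} {V : choiceType} (G : weighted_graph R V) (n K : R).
Hypothesis n_gt0 : 0 < n.
Implicit Types (f g : V -> R) (x y : V) (t s : R).
Notation P := (expheat G).
Notation D := (Delta G).

Lemma is_derive_Gamma_expheat f t x : bdd f ->
  is_derive t 1 (fun t => Gamma G (P t f) x)
    (2 * Gamma_bil G (P t f) (P t (D f)) x).
Proof.
move=> bf; have du := uderiv_expheat_id G t bf.
have := is_derive_uderiv x (uderiv_Gamma_bil G du du).
rewrite (Gamma_bilC _ (P t (D f))) fctE.
by rewrite (_ : _ + _ = 2 * Gamma_bil G (P t f) (P t (D f)) x); last by ring.
Qed.

(** The difference [F] of the two sides vanishes at 0, so its derivative there is nonnegative; by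
    [Delta_Gamma] the terms [Gamma(f, D f)] cancel. *)
Lemma curvature_of_gradient_bound f x : bdd f ->
  (forall t, 0 <= t -> Gamma G (P t f) x <=
    expR (2 * K * t) * P t (Gamma G f) x - quot1 K t / n * P t (D f) x ^+ 2) ->
  n^-1 * D f x ^+ 2 - K * Gamma G f x <= Gamma2 G f x.
Proof.
move=> bf H; have bDf := bdd_Delta G bf; have bGf := bdd_Gamma G bf.
have [q10 _ _ _] := quot_at0 K.
pose F t := expR (2 * K * t) * P t (Gamma G f) x
  - quot1 K t / n * P t (D f) x ^+ 2 - Gamma G (P t f) x.
have dF : is_derive (0 : R) 1 F (2 * K * Gamma G f x + D (Gamma G f) x
    - 2 / n * D f x ^+ 2 - 2 * Gamma_bil G f (D f) x).
  have dE := is_derive_expRM (2 * K) 0; have dq := is_derive_quot1 K 0.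
  have dG := is_derive_expheat G x 0 bGf; have dD := is_derive_expheat G x 0 bDf.
  have dGP := is_derive_Gamma_expheat 0 x bf.
  apply: is_derive_eq; rewrite /GRing.scale/= !expheat0//; last exact: bdd_Delta.
    by rewrite mulr0 expR0 q10; ring.
  exact: bdd_Delta.
have := derive_at0_ge0 dF.
rewrite Delta_Gamma !fctE /GRing.scale/= => H0.
suff : 0 <= 2 * K * Gamma G f x + (2 * Gamma2 G f x + 2 * Gamma_bil G f (D f) x)
    - 2 / n * D f x ^+ 2 - 2 * Gamma_bil G f (D f) x by lra.
apply: H0; last by move=> t t0; rewrite subr_ge0 H.
by rewrite /F mulr0 expR0 q10 !expheat0//; ring.
Qed.

Lemma Delta_sqr f x : D (f * f) x = 2 * (f x * D f x + Gamma G f x).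
Proof. by rewrite DeltaM !fctE /GRing.scale/= /Gamma; ring. Qed.

(** This is the second derivative at 0 of the flow of [f * f], through which [Gamma2] enters the
    variance inequalities. *)
Lemma Delta_Delta_sqr f x : D (D (f * f)) x =
  2 * (f x * D (D f) x + D f x ^+ 2) + 8 * Gamma_bil G f (D f) x
  + 4 * Gamma2 G f x.
Proof.
have -> : D (f * f) = 2 *: (f * D f) + 2 *: Gamma G f.
  by apply/funext => y; rewrite Delta_sqr !fctE /GRing.scale/=; ring.
rewrite Delta_linear -[2 *: Gamma G f]addr0 Delta_linear DeltaM Delta_Gamma.
rewrite (_ : D 0 = 0); last exact: (Delta_cst G 0).
by rewrite addr0 !fctE /GRing.scale/=; ring.
Qed.

(** [F] and its derivative [F1] vanish at 0, the latter by [Delta_sqr], so the second derivative at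
    0 is nonnegative; it is 4 times the curvature defect. *)
Lemma curvature_of_variance_upper_bound f x : bdd f ->
  (forall t, 0 <= t -> P t (f * f) x - P t f x ^+ 2 <=
    quot1 K t * P t (Gamma G f) x - quot2 K t / n * P t (D f) x ^+ 2) ->
  n^-1 * D f x ^+ 2 - K * Gamma G f x <= Gamma2 G f x.
Proof.
move=> bf H; have bDf := bdd_Delta G bf; have bGf := bdd_Gamma G bf.
have bDDf := bdd_Delta G bDf; have bDGf := bdd_Delta G bGf.
have bff := bddM bf bf; have bDff := bdd_Delta G bff.
have [q10 q20 _ _] := quot_at0 K.
pose F t := quot1 K t * P t (Gamma G f) x - quot2 K t / n * P t (D f) x ^+ 2
  - P t (f * f) x + P t f x ^+ 2.
pose F1 t := 2 * expR (2 * K * t) * P t (Gamma G f) x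
  + quot1 K t * P t (D (Gamma G f)) x
  - 2 * quot1 K t / n * P t (D f) x ^+ 2
  - quot2 K t / n * (2 * P t (D f) x * P t (D (D f)) x)
  - P t (D (f * f)) x + 2 * P t f x * P t (D f) x.
have dF (z : R) : is_derive z 1 F (F1 z).
  have dq1 := is_derive_quot1 K z; have dq2 := is_derive_quot2 K z.
  have d1 := is_derive_expheat G x z bGf; have d2 := is_derive_expheat G x z bDf.
  have d3 := is_derive_expheat G x z bff; have d4 := is_derive_expheat G x z bf.
  by apply: is_derive_eq; rewrite /F1 /GRing.scale/=; ring.
have dF1 : is_derive (0 : R) 1 F1
    (4 * (Gamma2 G f x + K * Gamma G f x - n^-1 * D f x ^+ 2)).
  have dE := is_derive_expRM (2 * K) 0.
  have dq1 := is_derive_quot1 K 0; have dq2 := is_derive_quot2 K 0.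
  have d1 := is_derive_expheat G x 0 bGf; have d2 := is_derive_expheat G x 0 bDf.
  have d3 := is_derive_expheat G x 0 bDff; have d4 := is_derive_expheat G x 0 bf.
  have d5 := is_derive_expheat G x 0 bDDf; have d6 := is_derive_expheat G x 0 bDGf.
  apply: is_derive_eq; rewrite /GRing.scale/= !expheat0//; do ?exact: bdd_Delta.
  rewrite mulr0 expR0 q10 q20.
  by rewrite Delta_Delta_sqr Delta_Gamma !fctE /GRing.scale/=; ring.
have := derive2_at0_ge0 dF dF1.
suff [-> -> /(_ erefl erefl)] : F 0 = 0 /\ F1 0 = 0.
  by move=> H0; suff : 0 <= 4 * (Gamma2 G f x + K * Gamma G f x - n^-1 * D f x ^+ 2);
    [lra|apply: H0 => t t0; have := H t t0; rewrite /F; lra].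
rewrite /F /F1 mulr0 expR0 q10 q20 !expheat0// Delta_sqr !fctE.
by split; ring.
Qed.

(** The same second-order comparison; since [quot3] vanishes at 0, the gradient term needs only its
    first derivative. *)
Lemma curvature_of_variance_lower_bound f x : bdd f ->
  (forall t, 0 <= t -> quot3 K t * Gamma G (P t f) x
      + quot4 K t / n * P t (D f) x ^+ 2 <= P t (f * f) x - P t f x ^+ 2) ->
  n^-1 * D f x ^+ 2 - K * Gamma G f x <= Gamma2 G f x.
Proof.
move=> bf H; have bDf := bdd_Delta G bf; have bDDf := bdd_Delta G bDf.
have bff := bddM bf bf; have bDff := bdd_Delta G bff.
have [_ _ q30 q40] := quot_at0 K.
pose F t := P t (f * f) x - P t f x ^+ 2 - quot3 K t * Gamma G (P t f) x
  - quot4 K t / n * P t (D f) x ^+ 2.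
pose F1 t := P t (D (f * f)) x - 2 * P t f x * P t (D f) x
  - 2 * expR (- 2 * K * t) * Gamma G (P t f) x
  - 2 * quot3 K t * Gamma_bil G (P t f) (P t (D f)) x
  - 2 * quot3 K t / n * P t (D f) x ^+ 2
  - quot4 K t / n * (2 * P t (D f) x * P t (D (D f)) x).
have dF (z : R) : is_derive z 1 F (F1 z).
  have dq3 := is_derive_quot3 K z; have dq4 := is_derive_quot4 K z.
  have d1 := is_derive_Gamma_expheat z x bf; have d2 := is_derive_expheat G x z bDf.
  have d3 := is_derive_expheat G x z bff; have d4 := is_derive_expheat G x z bf.
  by apply: is_derive_eq; rewrite /F1 /GRing.scale/=; ring.
have dF1 : is_derive (0 : R) 1 F1
    (4 * (Gamma2 G f x + K * Gamma G f x - n^-1 * D f x ^+ 2)).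
  have dE := is_derive_expRM (- 2 * K) 0.
  have dq3 := is_derive_quot3 K 0; have dq4 := is_derive_quot4 K 0.
  have d1 := is_derive_Gamma_expheat 0 x bf; have d2 := is_derive_expheat G x 0 bDf.
  have d3 := is_derive_expheat G x 0 bDff; have d4 := is_derive_expheat G x 0 bf.
  have d5 := is_derive_expheat G x 0 bDDf.
  have d6 := is_derive_uderiv x (uderiv_Gamma_bil G (uderiv_expheat_id G 0 bf)
    (uderiv_expheat_id G 0 bDf)).
  apply: is_derive_eq; rewrite /GRing.scale/= !expheat0//; do ?exact: bdd_Delta.
  rewrite mulr0 expR0 q30 q40.
  by rewrite Delta_Delta_sqr !fctE /GRing.scale/=; ring.
have := derive2_at0_ge0 dF dF1.
suff [-> -> /(_ erefl erefl)] : F 0 = 0 /\ F1 0 = 0.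
  by move=> H0; suff : 0 <= 4 * (Gamma2 G f x + K * Gamma G f x - n^-1 * D f x ^+ 2);
    [lra|apply: H0 => t t0; have := H t t0; rewrite /F; lra].
rewrite /F /F1 mulr0 expR0 q30 q40 !expheat0// Delta_sqr !fctE.
by split; ring.
Qed.

End Converses.

(** [quot1 K t / 2] is the integral of [e^(2Ks)] over the segment. *)
Lemma Rintegral_expRM_ge {R : realType} (K t q : R) (g : R -> R) : 0 <= t ->
  continuous g -> (forall s, 0 <= s <= t -> expR (2 * K * s) * q <= g s) ->
  quot1 K t / 2 * q <= \int[lebesgue_measure]_(s in `[0, t]) g s.
Proof.
move=> t0 cg qg; have [q10 _ _ _] := quot_at0 K.
have dF (z : R) : is_derive z 1 (fun s => quot1 K s / 2 * q) (expR (2 * K * z) * q).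
  by have dq := is_derive_quot1 K z; apply: is_derive_eq; rewrite /GRing.scale/=; field.
have cF : continuous (fun z => expR (2 * K * z) * q).
  by move=> z; apply: cvgMr_tmp; exact: is_derive_continuous (is_derive_expRM _ z).
have := Rintegral_is_derive t0 dF cF; rewrite q10 !mul0r subr0 => <-.
exact: le_Rintegral_segment.
Qed.

Theorem theorem3p1 (R : realType) (V : choiceType) (G : weighted_graph R V)
    (n K : R) (n_gt0 : 0 < n) :
  [/\ CD G n (- K) <->
      (forall (t : R) (f : V -> R) (x : V), 0 <= t -> pos_bounded f ->
        Gamma G (heat G t f) x <=
        expR (2 * K * t) * heat G t (Gamma G f) x
        - 2 / n * \int[lebesgue_measure]_(s in `[0, t])
            (expR (2 * K * s) *
             heat G s (fun y => heat G (t - s) (Delta G f) y ^+ 2) x)),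
      CD G n (- K) <->
      (forall (t : R) (f : V -> R) (x : V), 0 <= t -> pos_bounded f ->
        Gamma G (heat G t f) x <=
        expR (2 * K * t) * heat G t (Gamma G f) x
        - quot_lim K ((expR (2 * K * t) - 1) / K) (2 * t) / n
          * heat G t (Delta G f) x ^+ 2),
      CD G n (- K) <->
      (forall (t : R) (f : V -> R) (x : V), 0 <= t -> pos_bounded f ->
        heat G t (fun y => f y ^+ 2) x - heat G t f x ^+ 2 <=
        quot_lim K ((expR (2 * K * t) - 1) / K) (2 * t)
          * heat G t (Gamma G f) x
        - quot_lim K ((expR (2 * K * t) - 1 - 2 * K * t) / K ^+ 2)
            (2 * t ^+ 2) / n
          * heat G t (Delta G f) x ^+ 2)
    & CD G n (- K) <->
      (forall (t : R) (f : V -> R) (x : V), 0 <= t -> pos_bounded f ->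
        heat G t (fun y => f y ^+ 2) x - heat G t f x ^+ 2 >=
        quot_lim K ((1 - expR (- 2 * K * t)) / K) (2 * t)
          * Gamma G (heat G t f) x
        + quot_lim K ((expR (- 2 * K * t) - 1 + 2 * K * t) / K ^+ 2)
            (2 * t ^+ 2) / n
          * heat G t (Delta G f) x ^+ 2)].
Proof.
have pbdd (f : V -> R) : pos_bounded f -> bdd f.
  by case=> _; exact: bounded_fun_bdd.
have bdds (f : V -> R) : bdd f ->
    [/\ bdd (Delta G f), bdd (Gamma G f) & bdd (f * f)].
  by move=> bf; split; [exact: bdd_Delta|exact: bdd_Gamma|exact: bddM].
(* On the segment both [s] and [t - s] are nonnegative, where [heat] is [expheat]. *)
have integral_heat (t : R) (f : V -> R) x : 0 <= t -> bdd f ->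
    \int[lebesgue_measure]_(s in `[0, t]) (expR (2 * K * s) *
      heat G s (fun y => heat G (t - s) (Delta G f) y ^+ 2) x) =
    \int[lebesgue_measure]_(s in `[0, t]) (expR (2 * K * s) *
      expheat G s (expheat G (t - s) (Delta G f) * expheat G (t - s) (Delta G f)) x).
  move=> t0 bf; apply: eq_Rintegral => s; rewrite inE/= in_itv/= => /andP[s0 st].
  have bP := bdd_expheat G (t - s) (bdd_Delta G bf).
  rewrite (heatE G _ (bdd_Delta G bf)) ?subr_ge0// sqr_funE heatE//.
  exact: bddM.
split; split.
- move=> cd t f x t0 /pbdd bf; rewrite integral_heat// !heatE//.
    exact: gradient_bound_integral.
  exact: bdd_Gamma.
- move=> H; apply: CD_pos_bounded => f x pf; have bf := pbdd f pf.
  have bDf := bdd_Delta G bf; rewrite mulNr.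
  apply: curvature_of_gradient_bound => // t t0.
  have := H t f x t0 pf; rewrite integral_heat// !heatE//; last exact: bdd_Gamma.
  (* Inequality 1 gives 2: by Jensen the integrand is at least [e^(2Ks)] times the square in 2, and
     [Rintegral_expRM_ge] integrates this bound. *)
  move=> /le_trans; apply; rewrite lerD2l lerN2.
  rewrite -[leLHS](_ : 2 / n * (quot1 K t / 2 * expheat G t (Delta G f) x ^+ 2) = _);
    last by field; rewrite gt_eqF.
  rewrite ler_wpM2l ?divr_ge0 ?(ltW n_gt0)//.
  apply: Rintegral_expRM_ge => // [z|s /andP[s0 _]].
    apply: cvgM; first exact: is_derive_continuous (is_derive_expRM _ z).
    exact: is_derive_continuous (is_derive_sqr_flow G t z x bDf).
  by rewrite ler_wpM2l ?expR_ge0//; exact: expheat_sqr_flow_ge.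
- move=> cd t f x t0 /pbdd bf; have [bDf bGf _] := bdds f bf.
  by rewrite !heatE//; exact: gradient_bound.
- move=> H; apply: CD_pos_bounded => f x pf; have bf := pbdd f pf.
  have [bDf bGf _] := bdds f bf.
  rewrite mulNr; apply: curvature_of_gradient_bound => // t t0.
  by have := H t f x t0 pf; rewrite !heatE.
- move=> cd t f x t0 /pbdd bf; have [bDf bGf bff] := bdds f bf.
  by rewrite sqr_funE !heatE//; exact: variance_upper_bound.
- move=> H; apply: CD_pos_bounded => f x pf; have bf := pbdd f pf.
  have [bDf bGf bff] := bdds f bf.
  rewrite mulNr; apply: curvature_of_variance_upper_bound => // t t0.
  by have := H t f x t0 pf; rewrite sqr_funE !heatE.
- move=> cd t f x t0 /pbdd bf; have [bDf bGf bff] := bdds f bf.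
  by rewrite sqr_funE !heatE//; exact: variance_lower_bound.
- move=> H; apply: CD_pos_bounded => f x pf; have bf := pbdd f pf.
  have [bDf bGf bff] := bdds f bf.
  rewrite mulNr; apply: curvature_of_variance_lower_bound => // t t0.
  by have := H t f x t0 pf; rewrite sqr_funE !heatE.
Qed.
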